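(* Let $\Omega\subset\mathbb{C}^n$ be a hyperbolic domain, $p\in\partial\Omega$ and $\lambda\ge 1$. Let $U\subset\mathbb{C}^n$ be a neighbourhood of $p$, and assume that at least one of the following holds: (1) $p$ is a $\lambda$-visible point for $\Omega$, and $U$ is bounded; (2) $p$ is a $\lambda$-visible point for $\Omega\cap U$ and $\Omega$ is hyperbolic at $p$. Then there exist a neighbourhood $V\subset\subset U$ of $p$ and a constant $C\ge 1$ such that for all $z,w\in\Omega\cap V$ belonging to the same connected component of $\Omega\cap U$, $$k_{\Omega\cap U}(z,w)\le C\,k_\Omega(z,w).$$
   Context: Neighbourhoods are open subsets of $\mathbb{C}^n$; $A\subset\subset B$ means that the closure of $A$ is compact and contained in $B$. $\Delta\subset\mathbb{C}$ is the open unit disc. For a domain $\Omega\subset\mathbb{C}^n$, $z,w\in\Omega$, $v\in\mathbb{C}^n$: $\tilde l_\Omega(z,w)=\inf\{|\alpha|:\exists\,\varphi:\Delta\to\Omega \text{ holomorphic},\ \varphi(0)=z,\ \varphi(\alpha)=w\}$; the Lempert function is $l_\Omega(z,w)=\tanh^{-1}\tilde l_\Omega(z,w)$; the Kobayashi pseudodistance $k_\Omega$ is the largest pseudodistance on $\Omega$ not exceeding $l_\Omega$; the Kobayashi-Royden pseudometric is $\kappa_\Omega(z;v)=\inf\{|\alpha|:\exists\,\varphi:\Delta\to\Omega \text{ holomorphic},\ \varphi(0)=z,\ \alpha\varphi'(0)=v\}$. For an absolutely continuous curve $\gamma:I\to\Omega$ ($I$ a compact interval), its Kobayashi-Royden length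 is $l^\kappa_\Omega(\gamma)=\int_I\kappa_\Omega(\gamma(t);\gamma'(t))\,dt$. For an open set such as $\Omega\cap U$ that may be disconnected, these objects are computed in the relevant connected component. $\Omega$ is hyperbolic if $k_\Omega$ is a distance. For $p\in\partial\Omega$, $\Omega$ is said to be hyperbolic at $p$ if either $\Omega$ is bounded, or $\Omega$ is unbounded and $\liminf_{z\to p,\,w\to\infty} l_\Omega(z,w)>0$ (with $z,w\in\Omega$). For $\lambda\ge1$, $\epsilon\ge0$, an absolutely continuous curve $\gamma:I\to\Omega$ is a $(\lambda,\epsilon)$-geodesic for $\Omega$ if $l^\kappa_\Omega(\gamma|_{[t_1,t_2]})\le\lambda k_\Omega(\gamma(t_1),\gamma(t_2))+\epsilon$ for all $t_1\le t_2$ in $I$. A point $p\in\partial\Omega$ is a $(\lambda,\epsilon)$-visible point for $\Omega$ if for any bounded neighbourhood $U$ of $p$ there exist a neighbourhood $V\subset\subset U$ of $p$ and a compact set $K_{\lambda,\epsilon}\subset\Omega$ such that every $(\lambda,\epsilon)$-geodesic $\gamma:I\to\Omega$ for $\Omega$ joining a point of $\Omega\cap V$ to a point of $\Omega\setminus U$ satisfies $\gamma(I)\cap K_{\lambda,\epsilon}\ne\emptyset$. It is a $\lambda$-visible point for $\Omega$ if it is $(\lambda,\epsilon)$-visible for $\Omega$ for all $\epsilon\ge0$. *)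

(* Defs.v *)
From HB Require Import structures.
From mathcomp Require Import all_boot all_order all_algebra.
From mathcomp Require Import all_classical all_reals all_analysis.
From mathcomp Require Import complex.
Import Order.TTheory GRing.Theory Num.Theory.
Import numFieldNormedType.Exports.

Set Implicit Arguments.
Unset Strict Implicit.
Unset Printing Implicit Defensive.

Local Open Scope classical_set_scope.
Local Open Scope ring_scope.
Local Open Scope complex_scope.

(* [R[i]] has no topology in the libraries; it receives the one that every
   [numFieldType] carries.  Then ['rV[R[i]]_n] is C^n, normed over [R[i]] by
   the sup norm, and [derivable f z 1] for [f : R[i] -> 'rV[R[i]]_n] is complex
   differentiability at [z]. *)
HB.instance Definition _ (R : realType) :=
  NormedModule.copy R[i] (R[i] : numFieldType)^o.

Section Defs.
Context {R : realType} {n : nat}.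
Local Notation C := R[i].
Local Notation V := 'rV[R[i]]_n.
Local Notation normc := ComplexField.Normc.normc.
Implicit Types (D U W : set V) (p z w v : V) (gamma : R -> V).

Definition domain D := [/\ D !=set0, open D & connected D].

Definition boundary D : set V := closure D `\` interior D.

Definition relatively_compact W U := compact (closure W) /\ closure W `<=` U.

(* Only the values of [phi] on the open unit disc matter. *)
Definition holomorphic_disc D (phi : C -> V) :=
  forall zeta : C, `|zeta| < 1 -> D (phi zeta) /\ derivable phi zeta 1.

(* The infimum is [+oo] when no disc joins [z] to [w]; this does not happen in
   a domain. *)
Definition lempert_tilde D z w : \bar R :=
  ereal_inf [set (normc alpha)%:E | alpha in [set alpha : C |
    `|alpha| < 1 /\
    exists phi, [/\ holomorphic_disc D phi, phi 0 = z & phi alpha = w]]].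

Definition artanh (x : R) : R := ln ((1 + x) / (1 - x)) / 2.

(* [er_map] extends [artanh] by [+oo |-> +oo]. *)
Definition lempert D z w : \bar R := er_map artanh (lempert_tilde D z w).

Definition pseudodistance D (d : V -> V -> R) :=
  [/\ forall z, D z -> d z z = 0,
      forall z w, D z -> D w -> 0 <= d z w,
      forall z w, D z -> D w -> d z w = d w z &
      forall x y z, D x -> D y -> D z -> d x z <= d x y + d y z].

(* The pointwise supremum of all pseudodistances not exceeding the Lempert
   function is itself one of them, hence the largest. *)
Definition kobayashi_domain D z w : \bar R :=
  ereal_sup [set (d z w)%:E | d in [set d | pseudodistance D d /\
    forall x y, D x -> D y -> ((d x y)%:E <= lempert D x y)%E]].

(* For a possibly disconnected open [D], computed in the component of [z]; it
   is only meaningful for [w] in that component.  The Lempert function and the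
   Kobayashi-Royden pseudometric need no such provision: a disc in [D] stays
   in the component of its center. *)
Definition kobayashi D z w : \bar R :=
  kobayashi_domain (connected_component D z) z w.

Definition hyperbolic D :=
  forall z w, D z -> D w -> kobayashi D z w = 0%E -> z = w.

Definition kobayashi_royden D z v : \bar R :=
  ereal_inf [set (normc alpha)%:E | alpha in [set alpha : C |
    exists phi, [/\ holomorphic_disc D phi, phi 0 = z &
                    alpha *: derive1 phi 0 = v]]].

(* Filter of the [w --> infinity] in C^n; [M] is a real number seen in C. *)
Definition at_infinity : set_system V :=
  filter_from [set: R] (fun M => [set w : V | M%:C < `|w|]).

Definition hyperbolic_at D p :=
  bounded_set D \/
  (~ bounded_set D /\
   (0 < limf_einf (fun zw : V * V => lempert D zw.1 zw.2)
          (filter_prod (within D (nbhs p)) (within D at_infinity)))%E).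

(* C^n is not a normed space over [R] in the library, so the derivative of a
   curve with respect to its real parameter is spelled out; where the limit
   does not exist the value is arbitrary. *)
Definition velocity gamma (t : R) : V :=
  lim ((h^-1)%:C *: (gamma (t + h) - gamma t) @[h --> (0 : R)^']).

Definition absolutely_continuous_on (a b : R) gamma :=
  forall e : R, 0 < e -> exists2 d : R, 0 < d &
  forall (m : nat) (s t : 'I_m -> R),
    (forall i, [/\ a <= s i, s i <= t i & t i <= b]) ->
    (forall i j, i != j -> t i <= s j \/ t j <= s i) ->
    \sum_(i < m) (t i - s i) < d ->
    \sum_(i < m) `|gamma (t i) - gamma (s i)| < e%:C.

Definition kr_length D gamma (t1 t2 : R) : \bar R :=
  (\int[lebesgue_measure]_(t in `[t1, t2])
     kobayashi_royden D (gamma t) (velocity gamma t))%E.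

(* The curve is the restriction of [gamma] to [a, b]. *)
Definition geodesic D (lambda eps a b : R) gamma :=
  [/\ a <= b,
      absolutely_continuous_on a b gamma,
      forall t, a <= t <= b -> D (gamma t) &
      forall t1 t2, a <= t1 -> t1 <= t2 -> t2 <= b ->
        (kr_length D gamma t1 t2 <=
         lambda%:E * kobayashi D (gamma t1) (gamma t2) + eps%:E)%E].

Definition visible_eps D p (lambda eps : R) :=
  forall U, open U -> U p -> bounded_set U ->
  exists W, exists K : set V,
    [/\ open W, W p, relatively_compact W U, compact K /\ K `<=` D &
        forall a b gamma, geodesic D lambda eps a b gamma ->
          W (gamma a) -> ~ U (gamma b) ->
          exists2 t, a <= t <= b & K (gamma t)].

Definition visible D p (lambda : R) :=
  forall eps : R, 0 <= eps -> visible_eps D p lambda eps.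

End Defs.

(* Main.v *)
Require Import Defs.
From mathcomp Require Import all_boot all_order all_algebra.
From mathcomp Require Import all_classical all_reals all_analysis.
From mathcomp Require Import complex.
From mathcomp Require Import measurable_realfun ring lra zify.
Import Order.TTheory GRing.Theory Num.Theory.
Import numFieldNormedType.Exports.
Local Open Scope classical_set_scope.
Local Open Scope ring_scope.

(** Write D for Omega intersected with U.  Every curve used below is a chain of
    holomorphic discs, each run through along its radius at unit Poincare speed:
    the piece carried by the disc phi is t |-> phi (tanh t).  Such a chain of
    length L has three features that make it a substitute for general curves.
    Its Kobayashi-Royden speed is at most 1 off the finitely many breakpoints, so
    its Kobayashi-Royden length is at most L; the infimum of the lengths of the
    chains joining two points is exactly the Kobayashi distance
    ([kobayashiE]); and a chain whose length is within eps of that infimum is a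
    (lambda, eps)-geodesic ([chain_geodesic]), because the triangle inequality
    spreads the global defect eps over every subinterval.

    The comparison itself ([comparison_of_exits]) is local on these chains.
    Suppose that discs of Omega centered in a ball B around p send a fixed smaller
    disc of radius c into U.  Then each short step of a chain that stays in B can
    be replaced by a step in D that is at most 6/c times as long
    ([localized_reach]).  Let z and w be close to p and take a nearly minimal
    chain of Omega from z to w.  If it stays in B, the comparison follows at once.
    Otherwise it leaves B, so the distance from z to w in Omega is bounded below,
    and an additive error is harmless; visibility supplies a point of a fixed
    compact set K of D that can be reached from z, and likewise from w, at a cost
    comparable to that distance, and the distance of D is bounded on the part of
    K in one component.

    It remains to find c and the lower bound.  If p is visible for Omega
    ([comparison_visible]), letting eps tend to 0 with K fixed shows that the
    distance from z to the complement of U is at least the distance from z to K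
    ([visible_lower]), and the latter stays away from 0 as z tends to p because a
    chain from K to z must cross spheres around the points of K, on which the
    distance of the hyperbolic domain is bounded below.  If Omega is hyperbolic
    at p ([comparison_hyperbolic_at]), discs centered near p are uniformly bounded
    on a fixed smaller disc, hence uniformly Lipschitz there by Cauchy's estimate.

    Cauchy's estimate is also what makes the chains absolutely continuous, and it
    has to be proved for functions that are merely complex differentiable.  This
    is Goursat's argument, carried out with trapezoid sums over the boundaries of
    dyadic squares instead of integrals ([square_sum_small], [cauchy_estimate]). *)

Set Implicit Arguments.
Unset Strict Implicit.
Unset Printing Implicit Defensive.
Local Open Scope complex_scope.

(** * Complex modulus and real-valued norms *)

Section Modulus.
Context {R : realType}.
Local Notation C := R[i].
Local Notation normc := (@ComplexField.Normc.normc R).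
Implicit Types z w : C.

Lemma normC_normc z : `|z| = (normc z)%:C. Proof. by []. Qed.

Lemma normc_ge0 z : 0 <= normc z.
Proof. by rewrite -lecR -normC_normc normr_ge0. Qed.

Lemma normcN z : normc (- z) = normc z.
Proof. by apply: complexI; rewrite -!normC_normc normrN. Qed.

Lemma ler_normcD z w : normc (z + w) <= normc z + normc w.
Proof. by rewrite -lecR rmorphD /= -!normC_normc ler_normD. Qed.

Lemma normcM z w : normc (z * w) = normc z * normc w.
Proof. exact: ComplexField.Normc.normcM. Qed.

Lemma normcV z : normc z^-1 = (normc z)^-1.
Proof. exact: ComplexField.Normc.normcV. Qed.

Lemma normc_real (x : R) : normc x%:C = `|x|.
Proof. by rewrite /= expr0n /= addr0 sqrtr_sqr. Qed.

Lemma normci : normc 'i = 1.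
Proof. by rewrite /= expr0n /= add0r expr1n sqrtr1. Qed.

Lemma normc_sum (I : Type) (r : seq I) (P : pred I) (F : I -> C) :
  normc (\sum_(i <- r | P i) F i) <= \sum_(i <- r | P i) normc (F i).
Proof.
apply: (big_ind2 (fun a b => normc a <= b)) => //.
  by rewrite ComplexField.Normc.normc0.
move=> a b c d ab cd; apply: le_trans (ler_normcD _ _) _; exact: lerD.
Qed.

Lemma normc_eq0 z : (normc z == 0) = (z == 0).
Proof.
apply/eqP/eqP => [/ComplexField.Normc.eq0_normc //|->].
exact: ComplexField.Normc.normc0.
Qed.

Lemma normc_gt0 z : (0 < normc z) = (z != 0).
Proof. by rewrite lt0r normc_ge0 andbT normc_eq0. Qed.

Lemma ler_Re_normc z : `|complex.Re z| <= normc z.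
Proof. by rewrite -lecR -normC_normc normc_ge_Re. Qed.

Lemma ler_Im_normc z : `|complex.Im z| <= normc z.
Proof.
have := ler_Re_normc (z * 'i); rewrite ReiNIm normrN normcM normci mulr1.
by [].
Qed.

Lemma normc_ler_ReIm z : normc z <= `|complex.Re z| + `|complex.Im z|.
Proof.
rewrite {1}(complexE z); apply: le_trans (ler_normcD _ _) _.
by rewrite normcM normci mul1r !normc_real.
Qed.

Lemma normc_sqr z : normc z ^+ 2 = complex.Re z ^+ 2 + complex.Im z ^+ 2.
Proof. by case: z => a b /=; rewrite sqr_sqrtr // addr_ge0 // sqr_ge0. Qed.

End Modulus.

(** * Complex derivatives *)

Section RealNorm.
Context {R : realType}.
Local Notation C := R[i].
Local Notation normc := (@ComplexField.Normc.normc R).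

(** The norm of a complex normed space takes values in the complex numbers;
    this is the same norm as a real number, so that real arithmetic applies. *)
Definition rnorm {W : normedModType C} (v : W) : R := complex.Re `|v|.

Lemma posC (e : C) : (0 < e) -> 0 < complex.Re e /\ e = (complex.Re e)%:C.
Proof.
case: e => a b; rewrite ltcE /= => /andP[/eqP -> ->]; split => //.
Qed.

Section W.
Context {W : normedModType C}.
Implicit Types v w : W.

Lemma normE v : `|v| = (rnorm v)%:C.
Proof.
have /ger0_Im := normr_ge0 v; rewrite /rnorm.
by case: (`|v|) => a b /= ->.
Qed.

Lemma rnorm_ge0 v : 0 <= rnorm v.
Proof. by rewrite -lecR -normE normr_ge0. Qed.

Lemma rnorm0 : rnorm (0 : W) = 0.
Proof. by rewrite /rnorm normr0. Qed.

Lemma rnorm_eq0 v : (rnorm v == 0) = (v == 0).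
Proof. by rewrite -(inj_eq (@complexI R)) -normE normr_eq0. Qed.

Lemma rnorm_gt0 v : (0 < rnorm v) = (v != 0).
Proof. by rewrite lt0r rnorm_ge0 andbT rnorm_eq0. Qed.

Lemma rnormN v : rnorm (- v) = rnorm v.
Proof. by rewrite /rnorm normrN. Qed.

Lemma rnormB v w : rnorm (v - w) = rnorm (w - v).
Proof. by rewrite -rnormN opprB. Qed.

Lemma ler_rnormD v w : rnorm (v + w) <= rnorm v + rnorm w.
Proof. by rewrite -lecR rmorphD /= -!normE ler_normD. Qed.

Lemma ler_rdistD w v u : rnorm (v - u) <= rnorm (v - w) + rnorm (w - u).
Proof. by rewrite -[v - u](subrKA w) ler_rnormD. Qed.

Lemma rnormZ (a : C) v : rnorm (a *: v) = normc a * rnorm v.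
Proof. by apply: complexI; rewrite -normE normrZ rmorphM /= -normE. Qed.

Lemma nbhs_rnormP (x : W) (A : set W) :
  nbhs x A <-> exists2 d : R, 0 < d & forall y, rnorm (y - x) < d -> A y.
Proof.
split=> [/nbhs_normP[d /= /posC[d0 dE] dA]|[d d0 dA]].
  exists (complex.Re d) => // y yx; apply: dA => /=.
  by rewrite /ball_ /= distrC normE dE ltcR.
apply/nbhs_normP; exists d%:C; first by rewrite /= ltcR.
by move=> y; rewrite /ball_ /= distrC normE ltcR; exact: dA.
Qed.

End W.

Lemma rnormC (z : C) : rnorm z = normc z. Proof. by []. Qed.

Section Derivative.
Context {W : normedModType C}.
Implicit Types (f : C -> W) (z : C).

(** The limit of the difference quotients in multiplied form: it can be used at
    w = z and adds up over the sides of a square. *)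
Definition has_deriv f z (a : W) := forall e : R, 0 < e -> exists2 d : R, 0 < d &
  forall w, normc (w - z) < d -> rnorm (f w - f z - (w - z) *: a) <= e * normc (w - z).

Lemma has_derivP f z a : has_deriv f z a <-> derivable f z 1 /\ derive1 f z = a.
Proof.
have key (a' : W) : has_deriv f z a' <->
  (fun h : C => h^-1 *: (f (h *: 1 + z) - f z)) @ 0^' --> a'.
  clear a; move: a' => a.
  split => [fa|fa].
  - apply/cvgrPdist_le => /= e /posC[e0 ->].
    have [d d0 dP] := fa _ e0.
    have := dnbhs0_lt (e := d%:C : C); rewrite ltcR => /(_ C d0).
    apply: filterS2 (nbhs_dnbhs_neq (0 : C)) => h h0.
    rewrite normE ltcR => hd; rewrite distrC normE lecR.
    have := dP (h + z); rewrite addrK => /(_ hd).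
    move=> H; suff -> : h^-1 *: (f (h *: (1 : C) + z) - f z) - a =
       h^-1 *: (f (h + z) - f z - h *: a).
      by rewrite rnormZ normcV ler_pdivrMl ?normc_gt0 // mulrC.
    rewrite [in RHS]scalerBr scalerA mulVf // scale1r; congr (_ *: (f (_ + z) - _) - _).
    exact: mulr1.
  - move=> e e0; move/cvgrPdist_le : fa => /(_ e%:C); rewrite ltcR => /(_ e0).
    rewrite near_withinE => /nbhs_rnormP[d d0 dP]; exists d => // w wz.
    have [->|wz0] := eqVneq w z.
      by rewrite !subrr scale0r subr0 rnorm0 -rnormC rnorm0 mulr0.
    have := dP (w - z); rewrite subr0 => /(_ wz).
    rewrite subr_eq0 => /(_ wz0); rewrite distrC normE lecR.
    have -> : (w - z) *: (1 : C) + z = w by rewrite /GRing.scale /= mulr1 subrK.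
    have h1 : 0 < normc (w - z) by rewrite normc_gt0 subr_eq0.
    have -> : f w - f z - (w - z) *: a = (w - z) *: ((w - z)^-1 *: (f w - f z) - a).
      by rewrite scalerBr scalerA mulfV ?subr_eq0 // scale1r.
    by rewrite rnormZ mulrC ler_pM2r.
have dE (b : W) : (fun h : C => h^-1 *: (f (h *: 1 + z) - f z)) @ 0^' --> b ->
    derive1 f z = b.
  move=> fb; rewrite derive1E; apply/cvg_lim => //; exact: norm_hausdorff.
split=> [/key fa|[fd <-]].
  split; first by apply/cvg_ex; exists a.
  exact: dE.
by apply/key; move: (fd) => /cvg_ex[b] fb; rewrite (dE _ fb).
Qed.

Lemma derivable_has_deriv f z : derivable f z 1 -> has_deriv f z (derive1 f z).
Proof. by move=> fz; apply/has_derivP. Qed.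

Lemma has_deriv_derivable f z a : has_deriv f z a -> derivable f z 1.
Proof. by move=> /has_derivP[]. Qed.

Lemma has_deriv_cts f z a : has_deriv f z a -> forall e : R, 0 < e ->
  exists2 d : R, 0 < d & forall w, normc (w - z) < d -> rnorm (f w - f z) < e.
Proof.
move=> fa e e0; have [d d0 dP] := fa 1 ltr01.
have a2 : 0 < 2 + rnorm a by have := rnorm_ge0 a; lra.
have k0 : 0 < e / (2 + rnorm a) by rewrite divr_gt0.
exists (Num.min d (e / (2 + rnorm a))); first by rewrite lt_min d0.
move=> w; rewrite lt_min => /andP[/dP h1 h2].
rewrite -[f w - f z](subrK ((w - z) *: a)).
apply: le_lt_trans (ler_rnormD _ _) _; rewrite rnormZ.
have := rnorm_ge0 a; have := normc_ge0 (w - z); move: h2.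
rewrite ltr_pdivlMr //; nra.
Qed.

End Derivative.

End RealNorm.

(** * Discrete contour sums *)

Section DiscreteContour.
Context {R : realType}.
Local Notation C := R[i].
Local Notation normc := (@ComplexField.Normc.normc R).
Implicit Types (u v w d h : C) (f g : C -> C) (k : nat) (M : R).

(** Twice the trapezoid rule for the integral of f along a segment.  It is exact
    on affine functions, which is all that Goursat's argument asks of an
    integral. *)
Definition trap f u v := (f u + f v) * (v - u).

Definition edge f u d k := \sum_(j < k) trap f (u + d * j%:R) (u + d * j.+1%:R).

(** The sum around the square of corner u and side h * k, with mesh h; the
    top and left sides are run through backwards. *)
Definition square_sum f u h k :=
  edge f u h k + edge f (u + h * k%:R) ('i * h) k
  - edge f (u + 'i * h * k%:R) h k - edge f u ('i * h) k.

Definition on_square u h k w := exists2 j, (j <= k)%N &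
  [\/ w = u + h * j%:R, w = u + h * k%:R + 'i * h * j%:R,
      w = u + 'i * h * k%:R + h * j%:R | w = u + 'i * h * j%:R].

Lemma edgeD f u d k l :
  edge f u d (k + l) = edge f u d k + edge f (u + d * k%:R) d l.
Proof.
rewrite /edge big_split_ord /=; congr (_ + _); apply: eq_bigr => j _.
by congr trap; rewrite -?addnS natrD mulrDr addrA.
Qed.

(** The sides inside the big square are run through twice, in opposite
    directions, at the same grid points. *)
Lemma square_sum_split f u h k :
  square_sum f u h (k + k) =
  square_sum f u h k + square_sum f (u + h * k%:R) h k +
  square_sum f (u + 'i * h * k%:R) h k +
  square_sum f (u + h * k%:R + 'i * h * k%:R) h k.
Proof.
rewrite /square_sum !edgeD !natrD.
have -> : u + h * (k%:R + k%:R) = u + h * k%:R + h * k%:R by ring.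
have -> : u + 'i * h * (k%:R + k%:R) = u + 'i * h * k%:R + 'i * h * k%:R by ring.
have -> : u + 'i * h * k%:R + h * k%:R = u + h * k%:R + 'i * h * k%:R by ring.
have -> : u + 'i * h * k%:R + 'i * h * k%:R + h * k%:R =
          u + h * k%:R + 'i * h * k%:R + 'i * h * k%:R by ring.
have -> : u + h * k%:R + 'i * h * k%:R + h * k%:R =
          u + h * k%:R + h * k%:R + 'i * h * k%:R by ring.
ring.
Qed.

Lemma edge_comb f g c u d k :
  edge (fun w => f w - c * g w) u d k = edge f u d k - c * edge g u d k.
Proof.
rewrite /edge mulr_sumr -sumrB; apply: eq_bigr => j _; rewrite /trap; ring.
Qed.

Lemma square_sum_comb f g c u h k :
  square_sum (fun w => f w - c * g w) u h k =
  square_sum f u h k - c * square_sum g u h k.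
Proof. rewrite /square_sum !edge_comb; ring. Qed.

(** The trapezoid rule of b + c w telescopes along a primitive. *)
Lemma edge_affine b c u d k :
  edge (fun w => b + c * w) u d k =
  (2 * b + c * (2 * u + d * k%:R)) * (d * k%:R).
Proof.
elim: k => [|k ih]; first by rewrite /edge big_ord0 !mulr0.
move: ih; rewrite /edge big_ord_recr /= => ->; rewrite /trap -!natr1; ring.
Qed.

(** The discrete form of the fact that a closed form has no period. *)
Lemma square_sum_affine b c u h k : square_sum (fun w => b + c * w) u h k = 0.
Proof. rewrite /square_sum !edge_affine; ring. Qed.

Lemma eq_edge f g u d k :
  (forall j, (j <= k)%N -> f (u + d * j%:R) = g (u + d * j%:R)) ->
  edge f u d k = edge g u d k.
Proof.
move=> fg; apply: eq_bigr => j _; rewrite /trap !fg //; exact: ltnW.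
Qed.

Lemma eq_square_sum f g u h k :
  (forall w, on_square u h k w -> f w = g w) ->
  square_sum f u h k = square_sum g u h k.
Proof.
move=> fg; rewrite /square_sum; congr (_ + _ - _ - _); apply: eq_edge => j jk;
  apply: fg; exists j => //.
- exact: Or41.
- exact: Or42.
- exact: Or43.
- exact: Or44.
Qed.

Lemma edge_le f M u d k :
  (forall j, (j <= k)%N -> normc (f (u + d * j%:R)) <= M) ->
  normc (edge f u d k) <= 2 * M * normc d * k%:R.
Proof.
move=> fM; apply: le_trans (normc_sum _ _ _) _.
rewrite -[k in X in _ <= X]card_ord mulr_natr -sumr_const.
apply: ler_sum => j _; rewrite /trap normcM.
have -> : u + d * j.+1%:R - (u + d * j%:R) = d by rewrite -natr1; ring.
apply: ler_wpM2r; first exact: normc_ge0.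
apply: le_trans (ler_normcD _ _) _; rewrite mulr_natl mulr2n.
by apply: lerD; apply: fM => //; exact: ltnW.
Qed.

Lemma square_sum_le f M u h k :
  (forall w, on_square u h k w -> normc (f w) <= M) ->
  normc (square_sum f u h k) <= 8 * M * (normc h * k%:R).
Proof.
move=> fM; rewrite /square_sum.
have E1 : normc (edge f u h k) <= 2 * M * normc h * k%:R.
  by apply: edge_le => j jk; apply: fM; exists j => //; exact: Or41.
have ih : normc ('i * h) = normc h by rewrite normcM normci mul1r.
have E2 : normc (edge f (u + h * k%:R) ('i * h) k) <= 2 * M * normc h * k%:R.
  by rewrite -ih; apply: edge_le => j jk; apply: fM; exists j => //; exact: Or42.
have E3 : normc (edge f (u + 'i * h * k%:R) h k) <= 2 * M * normc h * k%:R.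
  by apply: edge_le => j jk; apply: fM; exists j => //; exact: Or43.
have E4 : normc (edge f u ('i * h) k) <= 2 * M * normc h * k%:R.
  by rewrite -ih; apply: edge_le => j jk; apply: fM; exists j => //; exact: Or44.
apply: le_trans (ler_normcD _ _) _; rewrite normcN.
apply: le_trans (lerD (ler_normcD _ _) (lexx _)) _; rewrite normcN.
apply: le_trans (lerD (lerD (ler_normcD _ _) (lexx _)) (lexx _)) _.
by lra.
Qed.

End DiscreteContour.

(** * Goursat's argument *)

Section Goursat.
Context {R : realType}.
Local Notation C := R[i].
Local Notation normc := (@ComplexField.Normc.normc R).

(** The left ends a l / 2^l increase and stay below every right end, so their
    supremum serves. *)
Lemma nested_dyadic (a : nat -> nat) :
  (forall l, a l.+1 = (a l).*2 \/ a l.+1 = (a l).*2.+1) ->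
  exists t : R, forall l, (a l)%:R <= t * 2 ^+ l <= (a l).+1%:R.
Proof.
move=> a2.
have p2 l : (0 : R) < 2 ^+ l by rewrite exprn_gt0.
have lo l k : (a l * 2 ^ k <= a (l + k))%N.
  elim: k => [|k ih]; first by rewrite muln1 addn0.
  rewrite addnS expnS.
  by case: (a2 (l + k)%N) => ->; move: ih; rewrite -muln2; set x := (2 ^ k)%N; nia.
have hi l k : ((a (l + k)).+1 <= (a l).+1 * 2 ^ k)%N.
  elim: k => [|k ih]; first by rewrite muln1 addn0.
  rewrite addnS expnS.
  by case: (a2 (l + k)%N) => ->; move: ih; rewrite -muln2; set x := (2 ^ k)%N; nia.
have cross l m : ((a l) * 2 ^ m <= (a m).+1 * 2 ^ l)%N.
  have [lm|/ltnW ml] := leqP l m.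
    rewrite -(subnKC lm) expnD mulnA.
    have := lo l (m - l)%N; have := hi l (m - l)%N.
    by set x := (2 ^ l)%N; nia.
  rewrite -(subnKC ml) expnD.
  have := hi m (l - m)%N; set x := (2 ^ m)%N; set y := (2 ^ _)%N.
  by set c := a _; nia.
pose E := [set (a l)%:R / 2 ^+ l | l in [set: nat]] : set R.
have ub l : ubound E ((a l).+1%:R / 2 ^+ l).
  move=> _ [m _ <-]; rewrite ler_pdivrMr // mulrAC ler_pdivlMr //.
  by rewrite -!natrX -!natrM ler_nat.
have E0 : E !=set0 by exists ((a 0)%:R / 2 ^+ 0); exists 0%N.
exists (sup E) => l; apply/andP; split.
  rewrite -ler_pdivrMr //; apply: ub_le_sup; last by exists l.
  by exists ((a 0).+1%:R / 2 ^+ 0); exact: ub.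
by rewrite -ler_pdivlMr //; apply: ge_sup.
Qed.

Variables (s : R) (f : C -> C).
Hypothesis s0 : 0 < s.

(** The square of side s starts at -s/3 in both coordinates, so that 0 lies on
    no dyadic grid line: 1/3 has no finite binary expansion. *)
Let coord l (a : nat) : R := s * (a%:R / 2 ^+ l - 3^-1).
Let corner l a b : C := coord l a +i* coord l b.
Let mesh m : C := (s / 2 ^+ m)%:C.
Let contour m l a b := square_sum f (corner l a b) (mesh m) (2 ^ (m - l)).

Let p2 l : (0 : R) < 2 ^+ l. Proof. by rewrite exprn_gt0. Qed.

Let pow_sub m l : (l <= m)%N -> (2 ^ (m - l))%:R = 2 ^+ m / 2 ^+ l :> R.
Proof.
move=> lm; by rewrite natrX -{2}(subnK lm) exprD mulfK // lt0r_neq0.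
Qed.

Let mesh_pow m l : (l <= m)%N -> mesh m * (2 ^ (m - l))%:R = (s / 2 ^+ l)%:C.
Proof.
move=> lm; rewrite /mesh -(rmorph_nat (real_complex R)) -rmorphM pow_sub //=.
congr (_%:C); field; by rewrite !lt0r_neq0.
Qed.

Let mesh_nat m j : mesh m * j%:R = (s / 2 ^+ m * j%:R)%:C.
Proof. by rewrite /mesh -(rmorph_nat (real_complex R)) -rmorphM. Qed.

Let imul (x : R) : 'i * x%:C = 0 +i* x :> C.
Proof. by congr (_ +i* _); rewrite /=; ring. Qed.

Let addRI (x y c : R) : (x +i* y) + c%:C = (x + c) +i* y :> C.
Proof. by congr (_ +i* _); rewrite /=; ring. Qed.

Let addII (x y c : R) : (x +i* y) + (0 +i* c) = x +i* (y + c) :> C.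
Proof. by congr (_ +i* _); rewrite /=; ring. Qed.

Let coordS l a : coord l a.+1 = coord l a + s / 2 ^+ l.
Proof. rewrite /coord -natr1; field; by rewrite lt0r_neq0. Qed.

Let coord2 l a : coord l.+1 a.*2 = coord l a.
Proof. rewrite /coord -muln2 natrM exprS; field; by rewrite lt0r_neq0. Qed.

Let contour_split m l a b : (l < m)%N -> contour m l a b =
  contour m l.+1 a.*2 b.*2 + contour m l.+1 a.*2.+1 b.*2 +
  contour m l.+1 a.*2 b.*2.+1 + contour m l.+1 a.*2.+1 b.*2.+1.
Proof.
move=> lm; rewrite /contour.
have -> : (2 ^ (m - l) = 2 ^ (m - l.+1) + 2 ^ (m - l.+1))%N.
  by rewrite addnn -mul2n -expnS subnSK.
rewrite square_sum_split -mulrA !mesh_pow // imul.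
by rewrite /corner !addRI !addII !coordS !coord2.
Qed.

Let on_contour m l a b w : (l <= m)%N ->
  on_square (corner l a b) (mesh m) (2 ^ (m - l)) w ->
  [/\ coord l a <= complex.Re w <= coord l a.+1,
      coord l b <= complex.Im w <= coord l b.+1 &
      exists c, complex.Re w = coord l c \/ complex.Im w = coord l c].
Proof.
move=> lm [j jk].
have jle : 0 <= s / 2 ^+ m * j%:R <= s / 2 ^+ l.
  apply/andP; split; first by rewrite mulr_ge0 // divr_ge0 // ltW.
  have : (j%:R : R) <= 2 ^+ m / 2 ^+ l by rewrite -pow_sub // ler_nat.
  move=> jl; have : s / 2 ^+ m * j%:R <= s / 2 ^+ m * (2 ^+ m / 2 ^+ l).
    by rewrite ler_wpM2l // divr_ge0 // ltW.
  by move/le_trans; apply; rewrite mulrA divfK // lt0r_neq0.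
have sl : 0 <= s / 2 ^+ l by rewrite divr_ge0 // ltW.
rewrite -!mulrA !mesh_pow // mesh_nat !imul /corner; move: jle => /andP[j0 j1].
case=> ->; rewrite ?addRI ?addII ?addRI /= !coordS; split; try lra.
- by exists b; right.
- by exists a.+1; left; rewrite coordS.
- by exists b.+1; right; rewrite coordS.
- by exists a; left.
Qed.

(** The numerator 3 c - 2^l is a nonzero integer.  This is the bound that keeps
    a function with a mild singularity at 0 under control on every contour. *)
Let coord_ge l c : s / 2 ^+ l / 3 <= `|coord l c|.
Proof.
rewrite /coord normrM (gtr0_norm s0) -!mulrA ler_pM2l //.
have -> : c%:R / 2 ^+ l - 3^-1 = ((3 * c)%:R - (2 ^ l)%:R) / (2 ^+ l * 3) :> R.
  rewrite natrM natrX; field; by rewrite lt0r_neq0.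
have n3 : (3 * c != 2 ^ l)%N.
  apply/eqP => e; have : (3 %| 2 ^ l)%N by rewrite -e dvdn_mulr.
  by rewrite Euclid_dvdX.
rewrite normrM normfV (gtr0_norm (x := 2 ^+ l * 3)) ?mulr_gt0 //.
rewrite -invfM -[leLHS]mul1r ler_pM2r ?invr_gt0 ?mulr_gt0 //.
case: (ltngtP (3 * c) (2 ^ l)) n3 => // h _.
  rewrite distrC -natrB ?(ltnW h) // normr_nat (ler_nat _ 1); lia.
rewrite -natrB ?(ltnW h) // normr_nat (ler_nat _ 1); lia.
Qed.

Let contour_ge m l a b w : (l <= m)%N ->
  on_square (corner l a b) (mesh m) (2 ^ (m - l)) w ->
  s / 2 ^+ l / 3 <= normc w.
Proof.
move=> lm /(on_contour lm)[_ _ [c [] e]].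
  by apply: le_trans (ler_Re_normc _); rewrite e coord_ge.
by apply: le_trans (ler_Im_normc _); rewrite e coord_ge.
Qed.

(** Goursat's theorem on a square, for a function that may have at 0 a singularity
    weaker than a simple pole.  A square is good when its contour sums are
    eventually at most a multiple of its mass, where the mass is the area plus
    an atom at 0; as the mass is additive, a bad square contains a bad quarter.
    The bad squares shrink to a point.  If it is not 0, the function is there
    affine up to an error that is small with respect to the area; if it is 0,
    the sum is small with respect to the atom. *)
Lemma square_sum_small (e : R) : 0 < e ->
  (forall z, - (s / 3) <= complex.Re z <= 2 * s / 3 ->
             - (s / 3) <= complex.Im z <= 2 * s / 3 -> z != 0 ->
             exists a, has_deriv f z a) ->
  (forall eta, 0 < eta -> exists2 d : R, 0 < d &
     forall w, w != 0 -> normc w < d -> normc w * normc (f w) <= eta) ->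
  exists m0, forall m, (m0 <= m)%N ->
  normc (square_sum f (- (s / 3) +i* - (s / 3)) (s / 2 ^+ m)%:C (2 ^ m)) <= e.
Proof.
move=> e0 fd f0.
(* the a-th dyadic interval of level l contains 1/3, the position of 0 *)
pose hole l a := ((3 * a < 2 ^ l) && (2 ^ l < 3 * a.+1))%N.
pose mass l a b : R := (4 ^+ l)^-1 + (hole l a && hole l b)%:R.
pose e' := e / 2.
have e'0 : 0 < e' by rewrite divr_gt0.
pose good l a b := exists2 m0, (l <= m0)%N & forall m, (m0 <= m)%N ->
  normc (contour m l a b) <= e' * mass l a b.
have goodS l a b : good l.+1 a.*2 b.*2 -> good l.+1 a.*2.+1 b.*2 ->
    good l.+1 a.*2 b.*2.+1 -> good l.+1 a.*2.+1 b.*2.+1 -> good l a b.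
  move=> [m1 lm1 g1] [m2 _ g2] [m3 _ g3] [m4 _ g4].
  exists (maxn (maxn m1 m2) (maxn m3 m4)).
    by rewrite !leq_max (ltnW lm1).
  move=> m; rewrite !geq_max => /andP[/andP[mm1 mm2] /andP[mm3 mm4]].
  rewrite contour_split ?(leq_trans lm1) //.
  apply: le_trans (ler_normcD _ _) _.
  apply: le_trans (lerD (ler_normcD _ _) (lexx _)) _.
  apply: le_trans (lerD (lerD (ler_normcD _ _) (lexx _)) (lexx _)) _.
  apply: le_trans (lerD (lerD (lerD (g1 _ mm1) (g2 _ mm2)) (g3 _ mm3)) (g4 _ mm4)) _.
  rewrite -!mulrDr ler_pM2l // /mass exprS.
  have -> : (4 ^+ l)^-1 = 4 * (4 * 4 ^+ l)^-1 :> R.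
    field; by rewrite expf_neq0.
  set q := (4 * _)^-1; rewrite -!natr1.
  have : ((hole l.+1 a.*2 && hole l.+1 b.*2) + (hole l.+1 a.*2.+1 && hole l.+1 b.*2)
    + (hole l.+1 a.*2 && hole l.+1 b.*2.+1) +
    (hole l.+1 a.*2.+1 && hole l.+1 b.*2.+1) <= (hole l a && hole l b))%N.
    have H c : (hole l.+1 c.*2 + hole l.+1 c.*2.+1 <= hole l c)%N.
      rewrite /hole expnS -muln2; set x := (2 ^ l)%N; lia.
    move: (H a) (H b).
    by case: (hole l a) (hole l b) (hole l.+1 a.*2) (hole l.+1 b.*2)
       (hole l.+1 a.*2.+1) (hole l.+1 b.*2.+1) => [] [] [] [] [] [].
  rewrite -(ler_nat R) !natrD; lra.
suff [m0 _ g] : good 0%N 0%N 0%N.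
  exists m0 => m /g; rewrite /contour subn0 /corner /coord mulr0n mul0r sub0r mulrN.
  rewrite /mass expr0 invr1 /= => /le_trans; apply.
  by rewrite /e' /hole /=; lra.
apply: contrapT => bad0.
pose next l (q : nat * nat) := let: (a, b) := q in
  if `[< ~ good l.+1 a.*2 b.*2 >] then (a.*2, b.*2) else
  if `[< ~ good l.+1 a.*2.+1 b.*2 >] then (a.*2.+1, b.*2) else
  if `[< ~ good l.+1 a.*2 b.*2.+1 >] then (a.*2, b.*2.+1) else (a.*2.+1, b.*2.+1).
pose q := fix q l := if l is l'.+1 then next l' (q l') else (0%N, 0%N).
have bad l : ~ good l (q l).1 (q l).2.
  elim: l => // l; rewrite [q l.+1]/=; case: (q l) => a b /= ih.
  case: asboolP => //= n1; case: asboolP => //= n2; case: asboolP => //= n3 g4.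
  by apply: ih; apply: goodS => //; apply: contrapT.
have q1 l : (q l.+1).1 = ((q l).1).*2 \/ (q l.+1).1 = ((q l).1).*2.+1.
  rewrite [q l.+1]/=; case: (q l) => a b /=.
  by do 3 (case: asboolP => _; first by [left|right]); right.
have q2 l : (q l.+1).2 = ((q l).2).*2 \/ (q l.+1).2 = ((q l).2).*2.+1.
  rewrite [q l.+1]/=; case: (q l) => a b /=.
  by do 3 (case: asboolP => _; first by [left|right]); right.
have [x xq] := nested_dyadic q1.
have [y yq] := nested_dyadic q2.
pose z : C := (s * (x - 3^-1)) +i* (s * (y - 3^-1)).
have coordP (t : R) l c : c%:R <= t * 2 ^+ l <= c.+1%:R ->
    coord l c <= s * (t - 3^-1) <= coord l c.+1.
  move=> /andP[]; rewrite /coord !ler_pM2l // !lerD2r -ler_pdivrMr // => -> /=.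
  by rewrite ler_pdivlMr.
have near l m w : (l <= m)%N ->
    on_square (corner l (q l).1 (q l).2) (mesh m) (2 ^ (m - l)) w ->
    normc (w - z) <= 2 * (s / 2 ^+ l).
  move=> lm /(on_contour lm)[wx wy _].
  have := coordP _ _ _ (xq l); have := coordP _ _ _ (yq l).
  move: wx wy; rewrite !coordS => wx wy zy zx.
  apply: le_trans (normc_ler_ReIm _) _.
  have -> : complex.Re (w - z) = complex.Re w - complex.Re z by case: (w).
  have -> : complex.Im (w - z) = complex.Im w - complex.Im z by case: (w).
  rewrite mulr_natl mulr2n; apply: lerD; rewrite ler_norml /=; lra.
have small (d : R) : 0 < d -> exists l, s / 2 ^+ l < d.
  move=> d0; have [k _ /(_ k (leqnn k)) /= kd] := near_infty_natSinv_lt (PosNum (divr_gt0 d0 s0)).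
  exists k.
  rewrite -ltr_pdivlMl // mulrC; apply: le_lt_trans kd.
  rewrite lef_pV2 ?posrE // -natrX ler_nat; exact: ltn_expl.
have [z0|z0] := eqVneq z 0.
  have [d d0 fd0] := f0 (e' / 24) ltac:(by rewrite divr_gt0).
  have [l ld] := small (d / 2) ltac:(by rewrite divr_gt0).
  apply: (bad l); exists l => // m lm.
  have h : hole l (q l).1 && hole l (q l).2.
    have H (t : R) c : s * (t - 3^-1) = 0 -> c%:R <= t * 2 ^+ l <= c.+1%:R -> hole l c.
      move=> /eqP; rewrite mulf_eq0 gt_eqF //= subr_eq0 => /eqP -> /andP[].
      rewrite ler_pdivlMl // ler_pdivrMl // -natrX -!natrM !ler_nat => h1 h2.
      have n3 c' : (3 * c' != 2 ^ l)%N.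
        apply/eqP => e3; have : (3 %| 2 ^ l)%N by rewrite -e3 dvdn_mulr.
        by rewrite Euclid_dvdX.
      move: (n3 c) (n3 c.+1); rewrite /hole !ltn_neqAle h1 h2 => -> /=.
      by rewrite eq_sym => ->.
    have [zx zy] : s * (x - 3^-1) = 0 /\ s * (y - 3^-1) = 0.
      by move: z0 => /eqP; rewrite /z eq_complex /= => /andP[/eqP -> /eqP ->].
    by rewrite (H x) ?(H y).
  have sl : 0 < s / 2 ^+ l by rewrite divr_gt0.
  (* on this contour the modulus of the variable is between s/(3*2^l) and 2s/2^l *)
  apply: le_trans (square_sum_le (M := e' / (8 * (s / 2 ^+ l))) _) _.
    move=> w ws; have wn := near _ _ _ lm ws; have wg := contour_ge lm ws.
    rewrite z0 subr0 in wn.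
    have w0 : 0 < normc w by apply: lt_le_trans wg; rewrite divr_gt0.
    have w0' : w != 0 by rewrite -normc_gt0.
    have := fd0 w w0' ltac:(lra).
    rewrite -ler_pdivlMl // => /le_trans; apply.
    rewrite mulrC -mulrA ler_pM2l // -invfM lef_pV2 ?posrE ?mulr_gt0 //; lra.
  have -> : normc (mesh m) * (2 ^ (m - l))%:R = s / 2 ^+ l.
    rewrite /mesh normc_real ger0_norm ?divr_ge0 ?ltW // pow_sub //.
    by rewrite mulrA divfK // lt0r_neq0.
  rewrite /mass h /=.
  have -> : 8 * (e' / (8 * (s / 2 ^+ l))) * (s / 2 ^+ l) = e'.
    field; by rewrite !lt0r_neq0.
  apply: ler_peMr; first exact: ltW.
  by rewrite lerDr invr_ge0 exprn_ge0.
have /(_ _ _ z0)[] := fd z.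
- have := coordP _ _ _ (xq 0%N); rewrite /coord /= !expr0; lra.
- have := coordP _ _ _ (yq 0%N); rewrite /coord /= !expr0; lra.
move=> a /(_ (e' / (16 * s ^+ 2))) [|d d0 dP].
  by rewrite divr_gt0 // mulr_gt0 // exprn_gt0.
have [l ld] := small (d / 2) ltac:(by rewrite divr_gt0).
apply: (bad l); exists l => // m lm.
have sl : 0 < s / 2 ^+ l by rewrite divr_gt0.
rewrite /contour.
have <- : square_sum (fun w => f w - 1 * ((f z - a * z) + a * w))
   (corner l (q l).1 (q l).2) (mesh m) (2 ^ (m - l)) =
   square_sum f (corner l (q l).1 (q l).2) (mesh m) (2 ^ (m - l)).
  by rewrite square_sum_comb square_sum_affine mulr0 subr0.
(* outside of 0 the affine part of f has contour sum 0 and only the error is left *)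
apply: le_trans (square_sum_le (M := e' / (16 * s ^+ 2) * (2 * (s / 2 ^+ l))) _) _.
  move=> w /(near _ _ _ lm) wn.
  have -> : f w - 1 * (f z - a * z + a * w) = f w - f z - (w - z) *: a.
    by rewrite /GRing.scale /=; ring.
  apply: le_trans (dP _ _) _; first by lra.
  by rewrite ler_pM2l // divr_gt0 // mulr_gt0 // exprn_gt0.
have -> : normc (mesh m) * (2 ^ (m - l))%:R = s / 2 ^+ l.
  rewrite /mesh normc_real ger0_norm ?divr_ge0 ?ltW // pow_sub //.
  by rewrite mulrA divfK // lt0r_neq0.
have -> : 8 * (e' / (16 * s ^+ 2) * (2 * (s / 2 ^+ l))) * (s / 2 ^+ l) = e' * (4 ^+ l)^-1.
  have -> : 4 ^+ l = 2 ^+ l * 2 ^+ l :> R by rewrite -exprMn; congr (_ ^+ _); ring.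
  field; by rewrite !lt0r_neq0.
by rewrite ler_pM2l // /mass lerDl.
Qed.

End Goursat.

(** * Cauchy's estimate *)

Section Winding.
Context {R : realType}.
Local Notation C := R[i].
Local Notation normc := (@ComplexField.Normc.normc R).

Let ImD (x y : C) : complex.Im (x + y) = complex.Im x + complex.Im y.
Proof. by case: x y => ? ? []. Qed.

Let ImN (x : C) : complex.Im (- x) = - complex.Im x.
Proof. by case: x. Qed.

(** The imaginary part of dw / w is the angle swept, and conj w * dw measures it:
    a side at distance at least s/3 from 0 sweeps a definite angle. *)
Lemma edge_inv_ge (k : nat) (u d : C) (s m : R) : 0 < s -> 0 <= m ->
  (forall j, (j <= k)%N -> let w := u + d * j%:R in
     m * s / 3 <= complex.Im ((w^*)%C * d) /\ normc w ^+ 2 <= 8 * s ^+ 2 / 9 /\ w != 0) ->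
  3 / 4 * m / s * k%:R <= complex.Im (edge GRing.inv u d k).
Proof.
move=> s0 m0 H.
have Im_sum (I : Type) (r : seq I) (F : I -> C) :
    complex.Im (\sum_(i <- r) F i) = \sum_(i <- r) complex.Im (F i).
  elim: r => [|i r ih]; first by rewrite !big_nil.
  by rewrite !big_cons -ih; case: (F i) (\sum_(_ <- _) F _) => a1 a2 [].
rewrite Im_sum -[k in X in X <= _]card_ord mulr_natr -sumr_const.
apply: ler_sum => j _; rewrite /trap.
have -> : u + d * j.+1%:R - (u + d * j%:R) = d by rewrite -natr1; ring.
have Q i : (i <= k)%N -> 3 / 8 * m / s <= complex.Im ((u + d * i%:R)^-1 * d).
  move=> /H; set w := u + _ => -[h1 [h2 w0]].
  have n0 : 0 < normc w ^+ 2 by rewrite exprn_gt0 // normc_gt0.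
  have -> : w^-1 = (normc w ^- 2)%:C * (w^*)%C.
    by rewrite invc_norm normC_normc -rmorphXn -fmorphV.
  rewrite -[_ * _ * d]mulrA.
  have -> : complex.Im ((normc w ^- 2)%:C * (w^*%C * d)) =
     normc w ^- 2 * complex.Im (w^*%C * d).
    by case: (w^*%C * d) => x y /=; rewrite mul0r addr0.
  rewrite ler_pdivlMl // ; apply: le_trans h1.
  have : normc w ^+ 2 * (3 / 8 * m / s) <= 8 * s ^+ 2 / 9 * (3 / 8 * m / s).
    by apply: ler_wpM2r => //; rewrite divr_ge0 ?mulr_ge0 // ltW.
  move/le_trans; apply; rewrite le_eqVlt; apply/orP; left; apply/eqP; field; by rewrite lt0r_neq0.
have q1 := Q j (ltnW (ltn_ord j)); have q2 := Q j.+1 (ltn_ord j).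
rewrite [X in complex.Im X]mulrDl ImD; have := lerD q1 q2; apply: le_trans.
by rewrite le_eqVlt; apply/orP; left; apply/eqP; field; rewrite lt0r_neq0.
Qed.

(** The contour winds around 0.  A lower bound uniform in the mesh replaces the
    exact period of dw / w. *)
Lemma square_sum_inv_ge (s : R) m : 0 < s ->
  3 <= normc (square_sum GRing.inv (- (s / 3) +i* - (s / 3)) (s / 2 ^+ m)%:C (2 ^ m)).
Proof.
move=> s0.
have p2 : (0 : R) < 2 ^+ m by rewrite exprn_gt0.
set k := (2 ^ m)%N; set h := s / 2 ^+ m.
have h0 : 0 < h by rewrite divr_gt0.
have hk : h * k%:R = s by rewrite /h /k natrX divfK // lt0r_neq0.
have jk j : (j <= k)%N -> 0 <= h * j%:R <= s.
  move=> jk; rewrite mulr_ge0 ?(ltW h0) //= -hk ler_pM2l // ler_nat //.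
have hj j : h%:C * j%:R = (h * j%:R)%:C :> C.
  by rewrite -(rmorph_nat (real_complex R)) -rmorphM.
have ihj j : 'i * h%:C * j%:R = 0 +i* (h * j%:R) :> C.
  by rewrite -mulrA hj; congr (_ +i* _); rewrite /=; ring.
have nsq (x y : R) : `|x| <= 2 * s / 3 -> `|y| <= 2 * s / 3 ->
    normc (x +i* y) ^+ 2 <= 8 * s ^+ 2 / 9.
  by move=> xs ys; rewrite normc_sqr /=; move: xs ys; rewrite !ler_norml; nra.
have n0x (x y : R) : x != 0 -> x +i* y != 0 :> C.
  by move=> x0; rewrite eq_complex negb_and x0.
have n0y (x y : R) : y != 0 -> x +i* y != 0 :> C.
  by move=> y0; rewrite eq_complex negb_and y0 orbT.
have hs : 3 / 4 * h / s * k%:R = 3 / 4.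
  by rewrite -hk; field; rewrite (lt0r_neq0 h0) /= pnatr_eq0 expn_eq0.
have addE (a b c d : R) : (a +i* b) + (c +i* d) = (a + c) +i* (b + d) :> C by [].
have side u d : (forall j, (j <= k)%N -> let w := u + d * j%:R in
     h * s / 3 <= complex.Im ((w^*)%C * d) /\ normc w ^+ 2 <= 8 * s ^+ 2 / 9 /\ w != 0) ->
    3 / 4 <= complex.Im (edge GRing.inv u d k).
  by move=> H; rewrite -hs; apply: edge_inv_ge => //; exact: ltW.
apply: le_trans (ler_Im_normc _); apply: le_trans (ler_norm _).
set u := _ +i* _.
have E1 : 3 / 4 <= complex.Im (edge GRing.inv u h%:C k).
  apply: side => j /jk j1 /=; rewrite hj /u addE /=; split; [nra|split].
    by apply: nsq; rewrite ler_norml; lra.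
  by apply: n0y; lra.
have E2 : 3 / 4 <= complex.Im (edge GRing.inv (u + h%:C * k%:R) ('i * h%:C) k).
  apply: side => j /jk j1 /=; rewrite ihj !hj hk /u !addE /=; split; [nra|split].
    by apply: nsq; rewrite ler_norml; lra.
  by apply: n0x; lra.
(* the top and left sides are reversed so as to turn counterclockwise *)
have oppE (f : C -> C) v d : edge f v d k = - edge f (v + d * k%:R) (- d) k.
  rewrite /edge (reindex_inj rev_ord_inj) /= -sumrN; apply: eq_bigr => j _.
  rewrite /trap.
  have -> : v + d * k%:R + - d * j%:R = v + d * (k - j.+1).+1%:R.
    rewrite subnSK // natrB ?(ltnW (ltn_ord j)) //; ring.
  have -> : v + d * k%:R + - d * j.+1%:R = v + d * (k - j.+1)%:R.
    rewrite natrB //; ring.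
  ring.
have E3 : complex.Im (edge GRing.inv (u + 'i * h%:C * k%:R) h%:C k) <= - (3 / 4).
  rewrite oppE ImN lerN2; apply: side => j /jk j1 /=.
  rewrite mulNr !hj ihj hk /u !addE /=; split; [nra|split].
    by apply: nsq; rewrite ler_norml; lra.
  by apply: n0y; lra.
have E4 : complex.Im (edge GRing.inv u ('i * h%:C) k) <= - (3 / 4).
  rewrite oppE ImN lerN2; apply: side => j /jk j1 /=.
  rewrite mulNr !ihj hk /u !addE /=; split; [nra|split].
    by apply: nsq; rewrite ler_norml; lra.
  by apply: n0x; lra.
rewrite /square_sum.
rewrite !ImD !ImN; lra.
Qed.

End Winding.

Section CauchyEstimate.
Context {R : realType}.
Local Notation C := R[i].
Local Notation normc := (@ComplexField.Normc.normc R).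

Lemma on_square_bounds (s : R) m w : 0 < s ->
  on_square (- (s / 3) +i* - (s / 3)) (s / 2 ^+ m)%:C (2 ^ m) w ->
  s / 3 <= normc w /\ normc w <= 4 * s / 3.
Proof.
move=> s0 [j jk].
have p2 : (0 : R) < 2 ^+ m by rewrite exprn_gt0.
set h := s / 2 ^+ m.
have h0 : 0 < h by rewrite divr_gt0.
have hk : h * (2 ^ m)%:R = s by rewrite /h natrX divfK // lt0r_neq0.
have {}jk : 0 <= h * j%:R <= s.
  by rewrite mulr_ge0 ?(ltW h0) //= -hk ler_pM2l // ler_nat.
have hj i : h%:C * i%:R = (h * i%:R)%:C :> C.
  by rewrite -(rmorph_nat (real_complex R)) -rmorphM.
have ihj i : 'i * h%:C * i%:R = 0 +i* (h * i%:R) :> C.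
  by rewrite -mulrA hj; congr (_ +i* _); rewrite /=; ring.
have addE (a b c d : R) : (a +i* b) + (c +i* d) = (a + c) +i* (b + d) :> C by [].
have up (x y : R) : `|x| <= 2 * s / 3 -> `|y| <= 2 * s / 3 ->
    normc (x +i* y) <= 4 * s / 3.
  by move=> xs ys; apply: le_trans (normc_ler_ReIm _) _ => /=; lra.
have lox (x y : R) : s / 3 <= `|x| -> s / 3 <= normc (x +i* y).
  by move=> xs; apply: le_trans (ler_Re_normc _).
have loy (x y : R) : s / 3 <= `|y| -> s / 3 <= normc (x +i* y).
  by move=> xs; apply: le_trans (ler_Im_normc _).
have nl (x : R) : s / 3 <= - x -> s / 3 <= `|x|.
  by move/le_trans; apply; rewrite -normrN ler_norm.
have nr (x : R) : s / 3 <= x -> s / 3 <= `|x|.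
  by move/le_trans; apply; rewrite ler_norm.
case=> ->; rewrite ?hj ?ihj ?hk ?addE /=; split;
  by [apply: up; rewrite ler_norml; lra|apply: loy; apply: nl; lra|apply: lox; apply: nr; lra
     |apply: loy; apply: nr; lra|apply: lox; apply: nl; lra].
Qed.

(** The quotient (f z - f 0 - a z) / z^2 is holomorphic off 0 with a singularity
    weaker than a pole, so its contour sums vanish in the limit.  Hence a times
    the contour sum of 1/z is close to the contour sum of (f z - f 0) / z^2,
    which is bounded through M. *)
Lemma cauchy_estimate0 (f : C -> C) (M r : R) (a : C) : 0 < r ->
  (forall z, normc z < r -> derivable f z 1) ->
  (forall z, normc z < r -> normc (f z) <= M) ->
  has_deriv f 0 a -> normc a <= 96 * M / r.
Proof.
move=> r0 fd fM fa.
pose s := r / 2.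
have s0 : 0 < s by rewrite /s; lra.
pose F := fun z : C => (f z - (f 0 + a * z)) * (z^-1 * z^-1).
have Fd z : - (s / 3) <= complex.Re z <= 2 * s / 3 ->
    - (s / 3) <= complex.Im z <= 2 * s / 3 -> z != 0 -> exists b, has_deriv F z b.
  move=> xs ys z0; suff /derivable_has_deriv : derivable F z 1.
    by exists (derive1 F z).
  apply: derivableM; last first.
    by apply: derivableM; apply: derivableV => //; exact: derivable_id.
  apply: derivableB.
    apply: fd; apply: le_lt_trans (normc_ler_ReIm _) _.
    have : `|complex.Re z| <= 2 * s / 3 by rewrite ler_norml; lra.
    have : `|complex.Im z| <= 2 * s / 3 by rewrite ler_norml; lra.
    by rewrite /s; lra.
  apply: derivableD; first exact: derivable_cst.
  by apply: derivableM; [exact: derivable_cst|exact: derivable_id].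
have F0 eta : 0 < eta -> exists2 d : R, 0 < d &
     forall w, w != 0 -> normc w < d -> normc w * normc (F w) <= eta.
  move=> /fa[d d0 dP]; exists d => // w w0 wd.
  have := dP w; rewrite subr0 rnormC => /(_ wd) H.
  have nw : 0 < normc w by rewrite normc_gt0.
  rewrite /F !normcM normcV.
  have -> : f w - (f 0 + a * w) = f w - f 0 - w *: a by rewrite /GRing.scale /=; ring.
  have -> : normc w * (normc (f w - f 0 - w *: a) * ((normc w)^-1 * (normc w)^-1)) =
     normc (f w - f 0 - w *: a) / normc w by field; rewrite lt0r_neq0.
  by rewrite ler_pdivrMr.
pose G := fun z : C => (f z - f 0) * (z^-1 * z^-1).
apply/ler_addgt0Pr => e e0.
have [m0 /(_ m0 (leqnn m0))] := square_sum_small s0 e0 Fd F0.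
rewrite (@eq_square_sum _ F (fun z => G z - a * z^-1)); last first.
  move=> w /on_square_bounds -/(_ s0)[w3 _].
  have w0 : w != 0 by rewrite -normc_gt0; apply: lt_le_trans w3; lra.
  by rewrite /F /G; field.
rewrite square_sum_comb => H.
have I3 := square_sum_inv_ge m0 s0.
have GM : normc (square_sum G (- (s / 3) +i* - (s / 3)) (s / 2 ^+ m0)%:C (2 ^ m0)) <=
    8 * (2 * M * (9 / s ^+ 2)) * (normc (s / 2 ^+ m0)%:C * (2 ^ m0)%:R).
  apply: square_sum_le => w /on_square_bounds -/(_ s0)[w3 w4].
  have w0 : 0 < normc w by lra.
  rewrite /G !normcM normcV; apply: ler_pM.
  - exact: normc_ge0.
  - by rewrite mulr_ge0 // invr_ge0 ltW.
  - apply: le_trans (ler_normcD _ _) _; rewrite normcN.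
    have := fM w; have := fM 0; rewrite ComplexField.Normc.normc0 => /(_ r0).
    by move=> h1 h2; have := h2 ltac:(rewrite /s in w4; lra); lra.
  - have -> : 9 / s ^+ 2 = (s / 3)^-1 * (s / 3)^-1.
      by field; rewrite lt0r_neq0.
    have wi : (normc w)^-1 <= (s / 3)^-1 by rewrite lef_pV2 ?posrE //; lra.
    have wi0 : 0 <= (normc w)^-1 by rewrite invr_ge0 ltW.
    exact: ler_pM.
move: GM; rewrite normc_real gtr0_norm ?divr_gt0 ?exprn_gt0 //.
rewrite natrX divfK ?expf_neq0 //.
set A := square_sum G _ _ _ in H *; set B := square_sum _ _ _ _ in H I3 * => GM.
have aB : normc a * normc B <= normc A + e.
  rewrite -normcM -[a * B](subKr A); apply: le_trans (ler_normcD _ _) _.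
  by rewrite normcN lerD2l.
have a0 := normc_ge0 a.
have a3 : normc a * 3 <= normc a * normc B by rewrite ler_wpM2l.
have E : 8 * (2 * M * (9 / s ^+ 2)) * s = 3 * (96 * M / r).
  by rewrite /s; field; rewrite lt0r_neq0.
rewrite E in GM; lra.
Qed.

Section Segment.
Context {W : normedModType C}.

(** The mean value inequality for vector-valued functions, by bisection: if the
    slope over an interval exceeds K + e, so does the slope over one of its
    halves, and the derivative at the limit point is too large. *)
Lemma segment_lipschitz (f : C -> W) (K a b : R) : a <= b ->
  (forall x, a <= x <= b -> exists2 d, has_deriv f x%:C d & rnorm d <= K) ->
  rnorm (f b%:C - f a%:C) <= K * (b - a).
Proof.
move=> ab fK.
have [->|a_b] := eqVneq a b; first by rewrite !subrr rnorm0 mulr0.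
have {a_b}ab' : 0 < b - a by rewrite subr_gt0 lt_neqAle a_b.
apply/ler_addgt0Pr => e0' e0'0.
pose e := e0' / (b - a).
have e0 : 0 < e by rewrite divr_gt0.
have -> : K * (b - a) + e0' = (K + e) * (b - a).
  by rewrite /e; field; rewrite lt0r_neq0.
pose pt l (c : nat) := a + (b - a) * (c%:R / 2 ^+ l).
have p2 l : (0 : R) < 2 ^+ l by rewrite exprn_gt0.
pose good l c := rnorm (f (pt l c.+1)%:C - f (pt l c)%:C) <= (K + e) * ((b - a) / 2 ^+ l).
have pt2 l c : pt l.+1 c.*2 = pt l c.
  by rewrite /pt -muln2 natrM exprS; congr (_ + _ * _); field; rewrite lt0r_neq0.
have goodS l c : good l.+1 c.*2 -> good l.+1 c.*2.+1 -> good l c.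
  rewrite /good -(pt2 l c.+1) -(pt2 l c) doubleS => g1 g2.
  apply: le_trans (ler_rdistD (f (pt l.+1 c.*2.+1)%:C) _ _) _.
  apply: le_trans (lerD g2 g1) _.
  rewrite le_eqVlt; apply/orP; left; apply/eqP; rewrite exprS.
  by field; rewrite lt0r_neq0.
suff : good 0%N 0%N.
  rewrite /good /pt !expr0 !divr1 mulr1 mulr0 addr0.
  by have -> : a + (b - a) = b by ring.
apply: contrapT => bad0.
pose next l c := if `[< ~ good l.+1 c.*2 >] then c.*2 else c.*2.+1.
pose q := fix q l := if l is l'.+1 then next l' (q l') else 0%N.
have bad l : ~ good l (q l).
  elim: l => // l; rewrite [q l.+1]/=; rewrite /next; case: asboolP => //= n1 ih n2.
  by apply: ih; apply: goodS => //; apply: contrapT.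
have [x xq] : exists t : R, forall l, (q l)%:R <= t * 2 ^+ l <= (q l).+1%:R.
  by apply: nested_dyadic => l; rewrite [q l.+1]/= /next; case: asboolP; [left|right].
pose z := a + (b - a) * x.
have zq l : pt l (q l) <= z <= pt l (q l).+1.
  have /andP[h1 h2] := xq l.
  by rewrite /pt /z !lerD2l !ler_pM2l // ler_pdivrMr // ler_pdivlMr // h1 h2.
have [|d fd dK] := fK z.
  have := zq 0%N; rewrite /pt /= !expr0 mulr0n mul0r mulr0 addr0 divr1 mulr1.
  by have -> : a + (b - a) = b by ring.
have [dl d0 dP] := fd e e0.
have near w : normc (w%:C - z%:C) < dl ->
    rnorm (f w%:C - f z%:C) <= (K + e) * `|w - z|.
  move=> wd; have := dP _ wd; rewrite -rmorphB normc_real => H.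
  rewrite -[f _ - _](subrK ((w - z)%:C *: d)) mulrDl addrC.
  apply: le_trans (ler_rnormD _ _) _; apply: lerD => //.
  by rewrite rnormZ normc_real mulrC ler_wpM2r.
have [k _ /(_ k (leqnn k)) /= kd] := near_infty_natSinv_lt (PosNum (divr_gt0 d0 ab')).
have hk : (b - a) / 2 ^+ k < dl.
  rewrite -ltr_pdivlMl // mulrC; apply: le_lt_trans kd.
  rewrite lef_pV2 ?posrE // -natrX ler_nat; exact: ltn_expl.
apply: (bad k); rewrite /good.
have /andP[z1 z2] := zq k.
have ptS : pt k (q k).+1 = pt k (q k) + (b - a) / 2 ^+ k.
  by rewrite /pt -natr1; field; rewrite lt0r_neq0.
have n1 : `|pt k (q k).+1 - z| = pt k (q k).+1 - z by rewrite ger0_norm ?subr_ge0.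
have n2 : `|pt k (q k) - z| = z - pt k (q k) by rewrite distrC ger0_norm ?subr_ge0.
apply: le_trans (ler_rdistD (f z%:C) _ _) _; rewrite [X in _ + X]rnormB.
have h1 := near (pt k (q k).+1); have h2 := near (pt k (q k)).
rewrite -!rmorphB !normc_real n1 n2 in h1 h2.
have := h1 ltac:(lra); have := h2 ltac:(lra); nra.
Qed.

End Segment.

Section Vector.
Context {n : nat}.
Local Notation V := 'rV[C]_n.

Lemma ler_entry_rnorm (v : V) j : normc (v 0 j) <= rnorm v.
Proof.
rewrite leNgt; apply/negP => vj.
have : ball (0 : V) (normc (v 0 j))%:C v.
  by rewrite mx_norm_ball /ball_ /= sub0r normrN normE ltcR.
by move=> [_ /(_ 0 j)]; rewrite mxE -ball_normE /ball_ /= sub0r normrN ltxx.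
Qed.

Lemma rnorm_le (v : V) K : 0 <= K -> (forall j, normc (v 0 j) <= K) -> rnorm v <= K.
Proof.
move=> K0 vK; rewrite -lecR -normE.
have [->|v0] := eqVneq `|v| 0; first by rewrite lecR.
have [[i j] /= vE] := mx_norm_neq0 v0; rewrite [leLHS]vE.
by rewrite (ord1 i) normC_normc lecR.
Qed.

Lemma has_deriv_entry (f : C -> V) z a j :
  has_deriv f z a -> has_deriv (fun w => f w 0 j) z (a 0 j).
Proof.
move=> fa e /fa[d d0 dP]; exists d => // w /dP; apply: le_trans.
by have := ler_entry_rnorm (f w - f z - (w - z) *: a) j; rewrite !mxE.
Qed.

Lemma cauchy_estimate (f : C -> V) (M r : R) z a : 0 < r ->
  (forall w, normc (w - z) < r -> derivable f w 1) ->
  (forall w, normc (w - z) < r -> rnorm (f w) <= M) ->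
  has_deriv f z a -> rnorm a <= 96 * M / r.
Proof.
move=> r0 fd fM fa.
have zr : normc (z - z) < r by rewrite subrr ComplexField.Normc.normc0.
have M0 : 0 <= M by apply: le_trans (fM _ zr); exact: rnorm_ge0.
apply: rnorm_le => [|j]; first by rewrite divr_ge0 ?mulr_ge0 // ltW.
apply: (@cauchy_estimate0 (fun w => f (w + z) 0 j)) => //.
- move=> w wr; have /derivable_has_deriv fw := fd (w + z) ltac:(by rewrite addrK).
  apply: (@has_deriv_derivable _ _ _ _ (derive1 f (w + z) 0 j)).
  move=> e /(has_deriv_entry j fw)[d d0 dP]; exists d => // x xd.
  have := dP (x + z); have -> : x + z - (w + z) = x - w by ring.
  exact.
- move=> w wr; apply: le_trans (ler_entry_rnorm _ _) _; apply: fM.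
  by rewrite addrK.
- move=> e /(has_deriv_entry j fa)[d d0 dP]; exists d => // x xd.
  have := dP (x + z); rewrite addrK add0r subr0; apply.
  by rewrite subr0 in xd.
Qed.

End Vector.
End CauchyEstimate.

(** * The hyperbolic tangent *)

Section Tanh.
Context {R : realType}.
Local Notation C := R[i].
Local Notation normc := (@ComplexField.Normc.normc R).
Implicit Types s t : R.

Definition tanh t : R := 1 - 2 / (expR (2 * t) + 1).

Let e1_gt0 t : 0 < expR t + 1.
Proof. by rewrite addr_gt0 // expR_gt0. Qed.

Let e1_neq0 t : expR t + 1 != 0.
Proof. by rewrite lt0r_neq0. Qed.

Lemma tanh0 : tanh 0 = 0.
Proof. by rewrite /tanh mulr0 expR0 -[1 + 1]/2 divff // subrr. Qed.

Lemma tanhN t : tanh (- t) = - tanh t.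
Proof.
rewrite /tanh mulrN expRN; have := expR_gt0 (2 * t); set x := expR _ => x0.
by field; rewrite !lt0r_neq0 //; lra.
Qed.

Lemma tanh_lt1 t : tanh t < 1.
Proof. by rewrite /tanh ltrBlDr ltrDl divr_gt0. Qed.

Lemma tanh_gtN1 t : -1 < tanh t.
Proof. by rewrite -[t]opprK tanhN ltrN2 tanh_lt1. Qed.

Lemma tanh_norm_lt1 t : `|tanh t| < 1.
Proof. by rewrite ltr_norml tanh_lt1 tanh_gtN1. Qed.

Lemma tanhD s t : tanh (s + t) = (tanh s + tanh t) / (1 + tanh s * tanh t).
Proof.
rewrite /tanh mulrDr expRD.
have := expR_gt0 (2 * t); have := expR_gt0 (2 * s).
set x := expR _; set y := expR _ => x0 y0.
have xy : 0 < x * y by rewrite mulr_gt0.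
field; rewrite !lt0r_neq0 //; try lra.
Qed.

Lemma tanhB_mul s t : tanh s - tanh t = tanh (s - t) * (1 - tanh s * tanh t).
Proof.
rewrite tanhD tanhN mulrN divfK // subr_eq0 eq_sym lt_eqF //.
have := tanh_norm_lt1 s; have := tanh_norm_lt1 t; rewrite !ltr_norml; nra.
Qed.

Lemma ler_tanh : {mono tanh : s t / s <= t}.
Proof.
move=> s t; rewrite /tanh lerD2l lerN2 ler_pM2l // lef_pV2 ?posrE //.
by rewrite lerD2r ler_expR ler_pM2l.
Qed.

Lemma ltr_tanh : {mono tanh : s t / s < t}.
Proof. exact: leW_mono ler_tanh. Qed.

Lemma tanh_ge0 t : (0 <= tanh t) = (0 <= t).
Proof. by rewrite -{1}tanh0 ler_tanh. Qed.

Lemma tanh_le2 t : 0 <= t -> tanh t <= 2 * t.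
Proof.
move=> t0; rewrite /tanh; have := expR_ge1Dx (- (2 * t)); rewrite expRN.
have x1 : 1 <= expR (2 * t) by rewrite -[leLHS]expR0 ler_expR mulr_ge0.
move: x1; set x := expR _ => x1 h.
have x0 : 0 < x by lra.
have h2 : x * (1 - 2 * t) <= 1.
  by rewrite -[leRHS](mulfV (lt0r_neq0 x0)) ler_pM2l.
have -> : 1 - 2 / (x + 1) = (x - 1) / (x + 1) by field; rewrite lt0r_neq0 //; lra.
rewrite ler_pdivrMr; nra.
Qed.

Lemma tanh_ge3 t : 0 <= t <= 2^-1 -> t / 3 <= tanh t.
Proof.
move=> /andP[t0 t1]; rewrite /tanh.
have := expR_ge1Dx (2 * t); have := expR_ge1Dx (- t); rewrite expRN.
have -> : expR (2 * t) = expR t * expR t by rewrite -expRD; congr expR; ring.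
have := expR_gt0 t; set y := expR t => y0 h1 h2.
have h3 : y * (1 - t) <= 1 by rewrite -[leRHS](mulfV (lt0r_neq0 y0)) ler_pM2l.
have h4 : y <= 2 by nra.
have -> : 1 - 2 / (y * y + 1) = (y * y - 1) / (y * y + 1) by field; rewrite lt0r_neq0 //; nra.
rewrite ler_pdivlMr; nra.
Qed.

Lemma tanh_lipschitz s t : `|tanh s - tanh t| <= 4 * `|s - t|.
Proof.
wlog st : s t / t <= s.
  by move=> H; have [/H//|/ltW /H] := leP t s; rewrite distrC [in leRHS]distrC.
rewrite !ger0_norm ?subr_ge0 ?ler_tanh // tanhB_mul.
have h := @tanh_le2 (s - t) ltac:(lra).
have h0 : 0 <= tanh (s - t) by rewrite tanh_ge0; lra.
have := tanh_norm_lt1 s; have := tanh_norm_lt1 t; rewrite !ltr_norml => a b.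
have : tanh s * tanh t >= -1 by nra.
nra.
Qed.

Lemma tanh_artanh (x : R) : -1 < x < 1 -> tanh (artanh x) = x.
Proof.
move=> /andP[x1 x2]; rewrite /tanh /artanh.
have x0 : 0 < (1 + x) / (1 - x) by rewrite divr_gt0; lra.
have -> : 2 * (ln ((1 + x) / (1 - x)) / 2) = ln ((1 + x) / (1 - x)) by field.
rewrite lnK ?posrE //; field; rewrite !lt0r_neq0 //; lra.
Qed.

Lemma tanh_derive0 : is_derive (0 : R) 1 tanh 1.
Proof.
have E : tanh = cst 1 - (2 : R) *: (fun t => (expR (2 * t) + 1)^-1).
  by apply/funext => t.
rewrite E.
have h : is_derive (0 : R) 1 (fun t => expR (2 * t) + 1) 2.
  apply: is_derive_eq; rewrite /= mulr0 expR0 /GRing.scale /=; ring.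
have h' := is_deriveV (f := fun t : R => expR (2 * t) + 1) (e1_neq0 (2 * 0)) h.
apply: is_derive_eq; rewrite mulr0 expR0 /GRing.scale /=; by field.
Qed.

Lemma tanh_ratio0 (e : R) : 0 < e -> exists2 d : R, 0 < d &
  forall h, h != 0 -> `|h| < d -> `|tanh h / h - 1| <= e.
Proof.
move=> e0; have [d1 d2] := tanh_derive0.
move: d1 => /cvg_ex[l /= dl].
have : l = 1 by rewrite -d2; apply/esym; exact: cvg_lim dl.
move=> l1; move: dl; rewrite l1 => /cvgrPdist_le /(_ e e0).
rewrite near_withinE => /nbhs_ballP[d /= d0 dP]; exists d => // h h0 hd.
have := dP h; rewrite /ball /= sub0r normrN => /(_ hd h0).
by rewrite tanh0 subr0 addr0 distrC /GRing.scale /= mulr1 mulrC.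
Qed.

End Tanh.

(* from here on only the properties above are used *)
Opaque tanh.

(** * Holomorphic discs *)

Section Discs.
Context {R : realType} {n : nat}.
Local Notation C := R[i].
Local Notation V := 'rV[R[i]]_n.
Local Notation normc := (@ComplexField.Normc.normc R).
Implicit Types (D : set V) (phi : C -> V) (s t : R).

Lemma holomorphic_discP D phi : holomorphic_disc D phi <->
  forall z : C, normc z < 1 -> D (phi z) /\ derivable phi z 1.
Proof.
by split=> H z z1; apply: H; move: z1; rewrite normC_normc (ltcR (normc z) 1).
Qed.

Lemma derivable_comp_disc phi (g : C -> C) z :
  derivable g z 1 -> derivable phi (g z) 1 -> derivable (fun w => phi (g w)) z 1.
Proof.
move=> gz pz; apply/derivable1_diffP; apply: differentiable_comp;
  exact/derivable1_diffP.
Qed.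

Lemma holomorphic_disc_comp D phi (g : C -> C) : holomorphic_disc D phi ->
  (forall z, normc z < 1 -> normc (g z) < 1 /\ derivable g z 1) ->
  holomorphic_disc D (fun z => phi (g z)).
Proof.
move=> /holomorphic_discP phiD gD; apply/holomorphic_discP => z /gD[g1 gd].
have [h1 h2] := phiD _ g1; split; first exact: h1.
exact: (derivable_comp_disc gd h2).
Qed.

Lemma holomorphic_disc_scale D phi (c : C) : holomorphic_disc D phi ->
  normc c <= 1 -> holomorphic_disc D (fun z => phi (c * z)).
Proof.
move=> phiD c1; apply: (holomorphic_disc_comp phiD) => z z1; split.
  by rewrite normcM; have := normc_ge0 z; have := normc_ge0 c; nra.
by apply: derivableM; [exact: derivable_cst|exact: derivable_id].
Qed.

Lemma normc_mobius (z : C) (T : R) : normc z < 1 -> -1 < T < 1 ->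
  normc ((z + T%:C) / (1 + T%:C * z)) < 1 /\ 1 + T%:C * z != 0.
Proof.
move=> z1 T1.
have key : normc (z + T%:C) ^+ 2 < normc (1 + T%:C * z) ^+ 2.
  rewrite !normc_sqr; have : normc z ^+ 2 < 1 by rewrite expr_lt1 ?normc_ge0.
  rewrite normc_sqr; case: (z) => x y /= xy.
  have : 0 < (1 - T * T) * (1 - (x ^+ 2 + y ^+ 2)) by apply: mulr_gt0; nra.
  nra.
have n0 : 0 < normc (1 + T%:C * z).
  rewrite lt0r normc_ge0 andbT; apply/eqP => e; move: key.
  by rewrite e expr0n /= ltNge sqr_ge0.
split; last by rewrite -normc_gt0.
by rewrite normcM normcV ltr_pdivrMr // mul1r -(@ltr_pXn2r _ 2) ?nnegrE ?normc_ge0.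
Qed.

Lemma derivable_mobius (z c : C) : 1 + c * z != 0 ->
  derivable (fun w : C => (w + c) / (1 + c * w)) z 1.
Proof.
move=> z0.
have d1 : derivable (fun w : C => 1 + c * w) z 1.
  apply: derivableD; first exact: derivable_cst.
  by apply: derivableM; [exact: derivable_cst|exact: derivable_id].
have d2 : derivable (fun w : C => w + c) z 1.
  by apply: derivableD; [exact: derivable_id|exact: derivable_cst].
have d3 := @derivableV _ _ (fun w : C => 1 + c * w) z 1 z0 d1.
exact: (derivableM d2 d3).
Qed.

(** Discs can be recentered along the radius; by the addition formula, the
    Moebius map that does it is a translation of the parameter t. *)
Lemma disc_shift D phi t : holomorphic_disc D phi ->
  exists2 psi, holomorphic_disc D psi &
    forall s, psi (tanh s)%:C = phi (tanh (s + t))%:C.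
Proof.
move=> phiD.
have t1 : -1 < tanh t < 1 by rewrite tanh_gtN1 tanh_lt1.
exists (fun z => phi ((z + (tanh t)%:C) / (1 + (tanh t)%:C * z))).
  apply: (holomorphic_disc_comp phiD (g := fun z => (z + (tanh t)%:C) / (1 + (tanh t)%:C * z))) => z z1.
  have [h1 h2] := normc_mobius z1 t1; split; first exact: h1.
  exact: derivable_mobius h2.
move=> s; congr phi; rewrite tanhD; move: (tanh s) (tanh t) => x y; rewrite rmorphM fmorphV !rmorphD rmorphM rmorph1 /=.
by rewrite [y%:C * _]mulrC.
Qed.

Lemma disc_reverse D phi t : holomorphic_disc D phi ->
  exists2 psi, holomorphic_disc D psi &
    forall s, psi (tanh s)%:C = phi (tanh (t - s))%:C.
Proof.
move=> /(disc_shift t)[psi psiD psiE].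
exists (fun z => psi (- 1 * z)).
  by apply: holomorphic_disc_scale => //; rewrite normcN ComplexField.Normc.normc1.
by move=> s; rewrite mulN1r -rmorphN -tanhN psiE addrC.
Qed.

(** The derivative is spelled out, as in the velocity of a curve, but it is also
    required to exist: this makes the property local and translation invariant. *)
Definition unit_speed D (gamma : R -> V) t := exists a : V,
  (forall e : R, 0 < e -> exists2 d : R, 0 < d & forall h : R, h != 0 -> `|h| < d ->
     rnorm ((h^-1)%:C *: (gamma (t + h) - gamma t) - a) <= e) /\
  (kobayashi_royden D (gamma t) a <= 1)%E.

Lemma unit_speed_velocity D gamma t : unit_speed D gamma t ->
  (kobayashi_royden D (gamma t) (velocity gamma t) <= 1)%E.
Proof.
move=> [a [da ka]]; suff -> : velocity gamma t = a by [].
apply: cvg_lim; first exact: norm_hausdorff.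
apply/cvgrPdist_le => e /posC[e0 ->].
have [d d0 dP] := da _ e0.
rewrite near_withinE; apply/nbhs_ballP; exists d => // h.
rewrite /ball /= sub0r normrN => hd h0; rewrite distrC normE lecR; exact: dP.
Qed.

(** After recentering at phi (tanh t), the velocity is the derivative of the
    recentered disc at 0, and that disc is a competitor with alpha = 1. *)
Lemma unit_speed_disc D phi t : holomorphic_disc D phi ->
  unit_speed D (fun s => phi (tanh s)%:C) t.
Proof.
move=> /(disc_shift t)[psi psiD psiE].
have psi0 : psi 0 = phi (tanh t)%:C.
  by have := psiE 0; rewrite tanh0 add0r rmorph0.
have := psiD; move/holomorphic_discP => /(_ 0).
rewrite ComplexField.Normc.normc0 => /(_ ltr01)[_ /derivable_has_deriv].
set a := derive1 psi 0 => da; exists a; split; last first.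
  apply: ereal_inf_lbound; exists 1; last by rewrite ComplexField.Normc.normc1.
  by exists psi; split => //; rewrite scale1r.
move=> e e0; pose K := 8 + rnorm a.
have a0 := rnorm_ge0 a.
have K0 : 0 < e / K by rewrite divr_gt0 // /K; lra.
have [d1 d10 dP1] := da _ K0.
have [d2 d20 dP2] := tanh_ratio0 K0.
exists (Num.min (d1 / 8) d2); first by rewrite lt_min d20 andbT; lra.
move=> h h0; rewrite lt_min => /andP[hd1 hd2].
have -> : phi (tanh (t + h))%:C - phi (tanh t)%:C = psi (tanh h)%:C - psi 0.
  by rewrite psi0 psiE [h + t]addrC.
have th : `|tanh h| <= 4 * `|h| by have := tanh_lipschitz h 0; rewrite tanh0 !subr0.
have := dP1 (tanh h)%:C; rewrite subr0 normc_real => /(_ ltac:(lra)) H1.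
have H2 := dP2 h h0 hd2.
have -> : (h^-1)%:C *: (psi (tanh h)%:C - psi 0) - a =
   (h^-1)%:C *: (psi (tanh h)%:C - psi 0 - (tanh h)%:C *: a) + (tanh h / h - 1)%:C *: a.
  move: (psi _ - psi 0) => u; move: (tanh h) => x.
  rewrite [in RHS]scalerBr scalerA -rmorphM.
  rewrite [(x / h - 1)%:C]rmorphB rmorph1 scalerBl scale1r.
  by rewrite [h^-1 * _]mulrC addrA subrK.
apply: le_trans (ler_rnormD _ _) _; rewrite !rnormZ !normc_real normfV.
have hp : 0 < `|h| by rewrite normr_gt0.
have : `|h|^-1 * rnorm (psi (tanh h)%:C - psi 0 - (tanh h)%:C *: a) <= e / K * 4.
  rewrite ler_pdivrMl //; apply: le_trans H1 _.
  have -> : `|h| * (e / K * 4) = e / K * (4 * `|h|) by ring.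
  by rewrite ler_pM2l.
have : `|tanh h / h - 1| * rnorm a <= e / K * rnorm a by rewrite ler_wpM2r.
have : e / K * K = e by rewrite divfK // lt0r_neq0 // /K; lra.
rewrite {2}/K; nra.
Qed.

Lemma unit_speed_near D gamma eta t : (exists2 d : R, 0 < d & forall s, `|s - t| < d ->
  gamma s = eta s) -> unit_speed D gamma t -> unit_speed D eta t.
Proof.
move=> [d d0 ge] [a [da ka]]; exists a.
have e0 : eta t = gamma t by rewrite ge // subrr normr0.
rewrite e0; split; last exact: ka.
move=> e /da[d1 d10 dP]; exists (Num.min d d1); first by rewrite lt_min d0.
move=> h h0; rewrite lt_min => /andP[h1 h2]; rewrite -ge; first exact: dP.
by rewrite [t + h]addrC addrK.
Qed.

Lemma unit_speed_shift D gamma c t : unit_speed D gamma (t - c) ->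
  unit_speed D (fun s => gamma (s - c)) t.
Proof.
move=> [a [da ka]]; exists a; split; last exact: ka.
move=> e /da[d d0 dP]; exists d; first exact: d0.
move=> h h0 hd; rewrite -[t + h - c]addrAC; exact: dP h0 hd.
Qed.

Lemma disc_deriv_le D phi (T r : R) M : 0 <= T -> 0 < r -> T + r <= 1 ->
  (forall z, normc z < T + r -> rnorm (phi z) <= M) -> holomorphic_disc D phi ->
  forall a b, 0 <= a -> a <= b -> b <= T ->
    rnorm (phi b%:C - phi a%:C) <= 96 * M / r * (b - a).
Proof.
move=> T0 r0 Tr phiM /holomorphic_discP phiD a b a0 ab bT.
apply: segment_lipschitz => // x xab.
have nx w : normc (w - x%:C) < r -> normc w < T + r.
  move=> wr; rewrite -[w](subrK x%:C); apply: le_lt_trans (ler_normcD _ _) _.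
  rewrite normc_real ger0_norm; lra.
have xT : normc x%:C < T + r by rewrite normc_real ger0_norm; lra.
have /derivable_has_deriv dx := (phiD x%:C ltac:(lra)).2.
exists (derive1 phi x%:C); first exact: dx.
apply: (cauchy_estimate r0 _ _ dx) => w /nx wr; last exact: phiM.
exact: (phiD w ltac:(lra)).2.
Qed.

End Discs.

(** * Compactness *)

Section Compactness.
Context {R : realType}.
Local Notation C := R[i].
Local Notation normc := (@ComplexField.Normc.normc R).

(** A monotone property that holds near each point of a compact set with some
    constant holds on the whole set with one constant. *)
Lemma compact_uniform (T : topologicalType) (K : set T) (P : R -> T -> Prop) :
  compact K -> (forall M M' x, M <= M' -> P M x -> P M' x) ->
  (forall x, K x -> exists M, \forall y \near x, P M y) ->
  exists M, forall x, K x -> P M x.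
Proof.
move=> /compact_near_coveringP Kc Pmono Kloc.
have [M [_ MP]] : \forall M \near +oo%R, K `<=` P M.
  apply: (Kc R +oo%R (fun M => P M)) => x /Kloc[M xM].
  exists (P M, [set M' | M < M']) => /=; first by split=> //; apply: nbhs_pinfty_gt; exact: num_real.
  by move=> [y M'] /= [yM MM']; apply: (Pmono M) => //; exact: ltW.
by exists (M + 1) => x; apply: MP; rewrite ltrDl.
Qed.

Lemma compact_rnorm_bound (T : topologicalType) (W : normedModType C) (K : set T)
    (f : T -> W) : compact K ->
  (forall x, K x -> forall e : R, 0 < e -> \forall y \near x, rnorm (f y - f x) < e) ->
  exists M, forall x, K x -> rnorm (f x) <= M.
Proof.
move=> Kc fc; apply: (@compact_uniform _ K (fun M x => rnorm (f x) <= M)) => //.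
  by move=> M M' x MM' /le_trans; apply.
move=> x /fc /(_ 1 ltr01) fx; exists (1 + rnorm (f x)).
apply: filterS fx => y fy; rewrite -[f y](subrK (f x)).
by apply: le_trans (ler_rnormD _ _) _; rewrite lerD2r ltW.
Qed.

Lemma has_deriv_continuous (W : normedModType C) (f : C -> W) z a : has_deriv f z a ->
  forall e : R, 0 < e -> \forall y \near z, rnorm (f y - f z) < e.
Proof.
by move=> /has_deriv_cts fc e /fc[d d0 dP]; apply/nbhs_rnormP; exists d.
Qed.

Lemma closed_rball (W : normedModType C) (p : W) r : closed [set y | rnorm (y - p) <= r].
Proof.
move=> x xc /=; rewrite leNgt; apply/negP => rx.
have [|y [/= yp yx]] := xc [set y | rnorm (y - x) < rnorm (x - p) - r].
  by apply/nbhs_rnormP; exists (rnorm (x - p) - r) => //; rewrite subr_gt0.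
have := ler_rdistD y x p; rewrite (rnormB x y); lra.
Qed.

Lemma compact_disc r : compact [set z : C | normc z <= r].
Proof.
pose f (q : R * R) : C := q.1%:C + 'i * q.2%:C.
have rc : continuous (fun x : R => x%:C : C).
  move=> x; apply/cvgrPdist_lt => e /posC[e0 ->]; apply/nbhs_ballP.
  exists (complex.Re e) => // y; rewrite /ball /= -rmorphB normC_normc normc_real.
  by rewrite ltcR.
have fc : continuous f.
  move=> q; apply: cvgD.
    by apply: (@continuous_comp _ _ _ fst (fun x : R => x%:C : C)); [exact: cvg_fst|exact: rc].
  apply: cvgM; first exact: cvg_cst.
  by apply: (@continuous_comp _ _ _ snd (fun x : R => x%:C : C)); [exact: cvg_snd|exact: rc].
have box : compact (f @` (`[- r, r] `*` `[- r, r])).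
  apply: continuous_compact; first by apply: continuous_subspaceT.
  by apply: compact_setX; exact: segment_compact.
apply: (subclosed_compact _ box).
  by have := @closed_rball C 0 r; congr closed; apply/seteqP; split=> z /=; rewrite subr0.
move=> z /= zr; exists (complex.Re z, complex.Im z); last by rewrite /f /= -complexE.
by split; rewrite /= in_itv /= -ler_norml; apply: le_trans zr;
  [exact: ler_Re_normc|exact: ler_Im_normc].
Qed.

Lemma compact_rball n (p : 'rV[C]_n) r : compact [set y | rnorm (y - p) <= r].
Proof.
have [r0|r0] := ltP r 0.
  rewrite (_ : mkset _ = set0); first exact: compact0.
  by apply/seteqP; split=> // y /= yp; have := rnorm_ge0 (y - p); lra.
have Kc := @rV_compact C n (fun _ => [set z : C | normc z <= r + rnorm p])
  (fun _ => @compact_disc _).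
apply: (subclosed_compact (@closed_rball 'rV[C]_n p r) Kc) => y /= yp i.
apply: le_trans (ler_entry_rnorm _ _) _; rewrite -[y](subrK p).
by apply: le_trans (ler_rnormD _ _) _; rewrite lerD2r.
Qed.

End Compactness.

(** * Chains of discs *)

Section Paths.
Context {R : realType} {n : nat}.
Local Notation C := R[i].
Local Notation V := 'rV[R[i]]_n.
Local Notation normc := (@ComplexField.Normc.normc R).
Implicit Types (D W : set V) (phi : C -> V) (g : R -> V) (s t L l : R) (x y z : V).

(** A chain of discs as a curve on [0, L]; its values outside of [0, L] have no
    meaning.  The parameter tanh t moves along the radius of the unit disc at
    Poincare speed 1, so L is the total Poincare length. *)
Inductive chain D : R -> (R -> V) -> Prop :=
| chain_disc phi L : 0 <= L -> holomorphic_disc D phi ->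
    chain D L (fun t => phi (tanh t)%:C)
| chain_cat L1 g1 L2 g2 : chain D L1 g1 -> chain D L2 g2 -> g1 L1 = g2 0 ->
    chain D (L1 + L2) (fun t => if t <= L1 then g1 t else g2 (t - L1)).

Definition reach D x y l := exists2 g, chain D l g & g 0 = x /\ g l = y.

Lemma chain_ge0 D L g : chain D L g -> 0 <= L.
Proof. by elim=> // L1 g1 L2 g2 _ h1 _ h2 _; exact: addr_ge0. Qed.

Lemma normc_tanh_lt1 t : normc (tanh t)%:C < 1.
Proof. by rewrite normc_real tanh_norm_lt1. Qed.

Lemma chain_in D L g t : chain D L g -> 0 <= t <= L -> D (g t).
Proof.
move=> gL; elim: gL t => [phi {}L L0 /holomorphic_discP phiD t tL|L1 g1 L2 g2 _ h1 _ h2 _ t tL].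
  exact: (phiD _ (normc_tanh_lt1 t)).1.
by case: ifPn => [tL1|]; [apply: h1; lra|rewrite -ltNge => L1t; apply: h2; lra].
Qed.

(** On a compact part of the radius the disc is bounded, so Cauchy's estimate
    bounds its derivative. *)
Lemma disc_lipschitz D phi L : 0 <= L -> holomorphic_disc D phi ->
  exists2 K : R, 0 <= K & forall s t, 0 <= s -> s <= t -> t <= L ->
    rnorm (phi (tanh t)%:C - phi (tanh s)%:C) <= K * (t - s).
Proof.
move=> L0 phiD; pose r := (1 - tanh L) / 2.
have L1 := tanh_lt1 L; have r0 : 0 < r by rewrite /r; lra.
have TL0 : 0 <= tanh L by rewrite tanh_ge0.
have [M MP] : exists M, forall z : C, normc z <= tanh L + r -> rnorm (phi z) <= M.
  apply: (@compact_rnorm_bound _ _ _ _ phi); first exact: compact_disc.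
  move=> z zr; apply: (@has_deriv_continuous _ _ _ _ (derive1 phi z)).
  apply: derivable_has_deriv; move/holomorphic_discP : phiD => /(_ z) [] //.
  by apply: le_lt_trans zr _; rewrite /r; lra.
have M0 : 0 <= M.
  by apply: le_trans (MP 0 _); [exact: rnorm_ge0|rewrite ComplexField.Normc.normc0; lra].
have K0 : 0 <= 96 * M / r by apply: divr_ge0; [exact: mulr_ge0|exact: ltW].
exists (96 * M / r * 4) => [|s t s0 st tL]; first by rewrite mulr_ge0.
apply: le_trans (disc_deriv_le TL0 r0 _ _ phiD _ _ _) _ => //.
- by rewrite /r; lra.
- by move=> z zr; apply: MP; exact: ltW.
- by rewrite tanh_ge0.
- by rewrite ler_tanh.
- by rewrite ler_tanh.
rewrite -[leRHS]mulrA; apply: ler_wpM2l => //.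
have := tanh_lipschitz t s; rewrite !ger0_norm ?subr_ge0 ?ler_tanh //.
Qed.

Lemma chain_lipschitz D L g : chain D L g ->
  exists2 K : R, 0 <= K & forall s t, 0 <= s -> s <= t -> t <= L ->
    rnorm (g t - g s) <= K * (t - s).
Proof.
elim=> [phi {}L|L1 g1 L2 g2 p1 [K1 K10 H1] p2 [K2 K20 H2] e]; first exact: disc_lipschitz.
exists (K1 + K2) => [|s t s0 st tL]; first exact: addr_ge0.
case: (leP t L1) => [tL1|L1t].
  rewrite (le_trans st) //; apply: le_trans (H1 _ _ s0 st tL1) _; nra.
case: (leP s L1) => [sL1|L1s].
  have h1 := H1 s L1 s0 sL1 (lexx _).
  have h2 := H2 0 (t - L1) (lexx 0) ltac:(lra) ltac:(lra).
  apply: le_trans (ler_rdistD (g1 L1) _ _) _; rewrite {1}e.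
  by nra.
have h2 := H2 (s - L1) (t - L1) ltac:(lra) ltac:(lra) ltac:(lra).
nra.
Qed.

Lemma chain_speed D L g : chain D L g ->
  exists S : seq R, forall t, 0 <= t <= L -> t \notin S -> unit_speed D g t.
Proof.
elim=> [phi {}L L0 phiD|L1 g1 L2 g2 p1 [S1 H1] p2 [S2 H2] e].
  by exists [::] => t _ _; exact: unit_speed_disc.
exists (L1 :: S1 ++ [seq u + L1 | u <- S2]) => t tL.
rewrite in_cons mem_cat !negb_or => /andP[tL1 /andP[tS1 tS2]].
case: (ltgtP t L1) tL1 => // h _.
  apply: (@unit_speed_near _ _ D g1); last by apply: H1 => //; lra.
  exists (L1 - t); first by rewrite subr_gt0.
  by move=> s; rewrite ltr_norml => st; rewrite ifT //; lra.
apply: (@unit_speed_near _ _ D (fun s => g2 (s - L1))).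
  exists (t - L1); first by rewrite subr_gt0.
  by move=> s; rewrite ltr_norml => st; rewrite ifF //; apply/negbTE; rewrite -ltNge; lra.
apply: unit_speed_shift; apply: H2; first by lra.
by apply: contra tS2 => h2; apply/mapP; exists (t - L1) => //; rewrite subrK.
Qed.

(** The induction principle behind all estimates along a chain: a relation that
    can be concatenated and holds for short radial steps of discs centered in W
    holds along every stretch of a chain that stays in W. *)
Lemma chain_rel (Rl : V -> V -> R -> Prop) D W (eta : R) : 0 < eta ->
  (forall x y z l l', Rl x y l -> Rl y z l' -> Rl x z (l + l')) ->
  (forall phi l, holomorphic_disc D phi -> W (phi 0) -> 0 <= l -> l < eta ->
     Rl (phi 0) (phi (tanh l)%:C) l) ->
  forall L g, chain D L g -> forall s t, 0 <= s -> s <= t -> t <= L ->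
    (forall u, s <= u <= t -> W (g u)) -> Rl (g s) (g t) (t - s).
Proof.
move=> eta0 Rcat Rdisc L g; elim=> [phi {}L L0 phiD s t s0 st tL gW|].
  have step a b : a <= b -> b - a < eta -> W (phi (tanh a)%:C) ->
      Rl (phi (tanh a)%:C) (phi (tanh b)%:C) (b - a).
    move=> ab abe Wa; have [psi psiD psiE] := disc_shift a phiD.
    have p0 : psi 0 = phi (tanh a)%:C by rewrite -[a]add0r -psiE tanh0.
    have pb : psi (tanh (b - a))%:C = phi (tanh b)%:C by rewrite psiE subrK.
    by rewrite -p0 -pb; apply: Rdisc => //; rewrite ?p0 ?subr_ge0.
  have [N tN] : exists N : nat, t - s < N%:R * (eta / 2).
    exists (Num.bound ((t - s) / (eta / 2))).
    rewrite -ltr_pdivrMr ?divr_gt0 //; apply: archi_boundP.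
    by rewrite divr_ge0 ?subr_ge0 // ltW // divr_gt0.
  elim: N s s0 st gW tN => [|N ih] s s0 st gW; first by rewrite mul0r; lra.
  rewrite -natr1 => tN.
  have [h|h] := ltP (t - s) eta; first by apply: step => //; apply: gW; rewrite lexx.
  have -> : t - s = (s + eta / 2 - s) + (t - (s + eta / 2)) by ring.
  apply: Rcat; [apply: step|apply: ih].
  - lra.
  - lra.
  - by apply: gW; rewrite lexx.
  - lra.
  - lra.
  - by move=> u us; apply: gW; lra.
  - lra.
move=> L1 g1 L2 g2 p1 H1 p2 H2 e s t s0 st tL gW.
case: (leP t L1) => [tL1|L1t].
  rewrite (le_trans st) //; apply: H1 => // u us.
  by have := gW u us; rewrite ifT //; lra.
case: (leP s L1) => [sL1|L1s].
  have -> : t - s = (L1 - s) + (t - L1 - 0) by ring.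
  apply: (Rcat _ (g1 L1)).
    by apply: H1 => // u us; have := gW u ltac:(lra); rewrite ifT //; lra.
  rewrite e; apply: H2; rewrite ?lexx //; [lra|lra|] => u us.
  have := gW (u + L1) ltac:(lra); case: ifPn => [h|_]; last by rewrite addrK.
  have -> : u = 0 by lra.
  by rewrite add0r -e.
have -> : t - s = t - L1 - (s - L1) by ring.
apply: H2; [lra|lra|lra|] => u us.
have := gW (u + L1) ltac:(lra); rewrite ifF ?addrK //.
by apply/negbTE; rewrite -ltNge; lra.
Qed.

Lemma reach_ge0 D x y l : reach D x y l -> 0 <= l.
Proof. by move=> [g /chain_ge0]. Qed.

Lemma reach_cat D x y z l l' : reach D x y l -> reach D y z l' -> reach D x z (l + l').
Proof.
move=> [g1 p1 [g10 g1l]] [g2 p2 [g20 g2l]].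
exists (fun t => if t <= l then g1 t else g2 (t - l)).
  by apply: chain_cat => //; rewrite g1l g20.
rewrite (chain_ge0 p1); split=> //; case: ifPn => [h|_]; last by rewrite addrAC subrr add0r.
have l0 : l' = 0 by have := chain_ge0 p2; lra.
by rewrite -g2l l0 addr0 g1l g20.
Qed.

Lemma reach_disc D phi l : holomorphic_disc D phi -> 0 <= l ->
  reach D (phi 0) (phi (tanh l)%:C) l.
Proof.
by move=> phiD l0; exists (fun t => phi (tanh t)%:C); [exact: chain_disc|rewrite tanh0].
Qed.

Lemma reach_sym D x y l : reach D x y l -> reach D y x l.
Proof.
move=> [g gl [<- <-]]; elim: gl => [phi L L0 phiD|L1 g1 L2 g2 p1 h1 p2 h2 e].
  have [psi psiD psiE] := disc_reverse L phiD.
  have p0 : psi 0 = phi (tanh L)%:C by rewrite -[in RHS](subr0 L) -psiE tanh0.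
  by have := reach_disc psiD L0; rewrite p0 psiE subrr tanh0.
rewrite (chain_ge0 p1) addrC; apply: reach_cat h1; rewrite e.
case: ifPn => [h|_].
  have l0 : L2 = 0 by have := chain_ge0 p2; lra.
  by move: h2; rewrite l0 add0r e.
by rewrite addrK.
Qed.

Lemma chain_reach D L g s t : chain D L g -> 0 <= s -> s <= t -> t <= L ->
  reach D (g s) (g t) (t - s).
Proof.
move=> gL s0 st tL; apply: (@chain_rel (reach D) D setT 1 _ _ _ _ _ gL) => //.
  by move=> x y z l l'; exact: reach_cat.
by move=> phi l phiD _ l0 _; exact: reach_disc.
Qed.

End Paths.

(** * The Kobayashi distance as an infimum over chains *)

Section Distance.
Context {R : realType} {n : nat}.
Local Notation C := R[i].
Local Notation V := 'rV[R[i]]_n.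
Local Notation normc := (@ComplexField.Normc.normc R).
Implicit Types (D W : set V) (phi : C -> V) (g : R -> V) (s t L l : R) (x y z : V).

Lemma reach_refl D x : D x -> reach D x x 0.
Proof.
by move=> Dx; apply: (@reach_disc _ _ _ (fun=> x)).
Qed.

Lemma reach_component D x y l : reach D x y l -> connected_component D x y.
Proof.
move=> [g gL [<- <-]]; have L0 := chain_ge0 gL.
have [K K0 gK] := chain_lipschitz gL.
apply: (@connected_component_max _ D (g @` `[0, l]%classic)).
- by exists 0 => //=; rewrite in_itv /= lexx.
- by move=> _ [t tl <-]; apply: (chain_in gL); move: tl; rewrite /= in_itv.
- apply: connected_continuous_connected; first exact: segment_connected.
  apply/subspace_continuousP => t /= tl; rewrite in_itv /= in tl.
  apply/cvgrPdist_lt => e /posC[e0 ->].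
  have K1 : 0 < K + 1 by lra.
  rewrite near_withinE; apply/nbhs_ballP; exists (complex.Re e / (K + 1)).
    by rewrite /= divr_gt0.
  move=> u; rewrite /ball /= ltr_pdivlMr // => tu; rewrite in_itv /= => ul.
  rewrite normE ltcR; suff : rnorm (g t - g u) < complex.Re e by [].
  case: (leP u t) => ut.
    have := gK u t ltac:(lra) ut ltac:(lra).
    by move: tu; rewrite ger0_norm ?subr_ge0 //; nra.
  have tu' : `|t - u| = u - t by rewrite distrC gtr0_norm ?subr_gt0.
  rewrite tu' in tu; rewrite (rnormB (g t)).
  by have := gK t u ltac:(lra) (ltW ut) ltac:(lra); nra.
- by exists l => //=; rewrite in_itv /= lexx L0.
Qed.

(** A point close to the center of a ball in D is reached along an affine disc,
    at a cost proportional to its distance to the center. *)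
Lemma reach_near D x r y : 0 < r -> (forall w, rnorm (w - x) < r -> D w) ->
  rnorm (y - x) <= r / 12 -> reach D x y (6 * rnorm (y - x) / r).
Proof.
move=> r0 Dr yx; set d := rnorm (y - x) in yx *.
have [d0|d0] := eqVneq d 0.
  have -> : y = x by apply/eqP; rewrite -subr_eq0 -rnorm_eq0; apply/eqP.
  by rewrite d0 mulr0 mul0r; apply: reach_refl; apply: Dr; rewrite subrr rnorm0.
have {}d0 : 0 < d by rewrite lt0r d0 rnorm_ge0.
set l := 6 * d / r.
have l0 : 0 < l by rewrite divr_gt0 // mulr_gt0.
have lr : l * r = 6 * d by rewrite /l divfK // lt0r_neq0.
have l2 : l <= 2^-1 by rewrite /l ler_pdivrMr //; lra.
have th := @tanh_ge3 _ l ltac:(lra).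
have th0 : 0 < tanh l by lra.
have dr : d <= tanh l * (r / 2) by nra.
pose phi (z : C) := x + z *: ((tanh l)^-1%:C *: (y - x)).
have phi0 : phi 0 = x by rewrite /phi scale0r addr0.
have phil : phi (tanh l)%:C = y.
  by rewrite /phi scalerA -rmorphM mulfV ?lt0r_neq0 // rmorph1 scale1r addrC subrK.
rewrite -[x in reach _ x]phi0 -[y in reach _ _ y]phil; apply: reach_disc; last exact: ltW.
apply/holomorphic_discP => z z1; split.
  apply: Dr; rewrite /phi addrAC subrr add0r !rnormZ normc_real normfV gtr0_norm // -/d.
  have : (tanh l)^-1 * d <= r / 2 by rewrite ler_pdivrMl.
  have : 0 <= (tanh l)^-1 * d by rewrite mulr_ge0 ?invr_ge0 // ltW.
  have := normc_ge0 z; nra.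
apply: derivableD; first exact: derivable_cst.
apply: (@has_deriv_derivable _ _ _ _ ((tanh l)^-1%:C *: (y - x))) => e e0.
exists 1 => // w _; rewrite -scalerBl subrr rnorm0.
by rewrite mulr_ge0 ?normc_ge0 // ltW.
Qed.

Lemma open_has_rball D x : open D -> D x ->
  exists2 r : R, 0 < r & forall w, rnorm (w - x) < r -> D w.
Proof. by move=> Do Dx; apply/nbhs_rnormP; exact: open_nbhs_nbhs. Qed.

(** Both the set of points that can be reached from x and its complement in D
    are open. *)
Lemma component_reach D x y : open D -> connected_component D x y ->
  exists l, reach D x y l.
Proof.
move=> Do Dxy.
have Dx : D x by apply: contrapT => /connected_component_out Dx; rewrite Dx in Dxy.
pose A := [set w | exists l, reach D x w l].
have AD : A `<=` D by move=> w [l /reach_component /connected_component_sub].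
have loc w : D w -> exists2 r : R, 0 < r & forall w', rnorm (w' - w) < r -> A w <-> A w'.
  move=> /(open_has_rball Do)[r r0 rD]; exists (r / 12); first by rewrite divr_gt0.
  move=> w' /ltW w'r; have ww' := reach_near r0 rD w'r.
  split=> -[l xl]; first by exists (l + 6 * rnorm (w' - w) / r); exact: reach_cat ww'.
  by exists (l + 6 * rnorm (w' - w) / r); apply: reach_cat xl _; exact: reach_sym.
have Ao : open A.
  move=> w Aw; have [r r0 rA] := loc w (AD _ Aw).
  by apply/nbhs_rnormP; exists r => // w' /rA h; exact/h.
have Bo : open (D `\` A).
  move=> w [Dw nAw]; have [r r0 rA] := loc w Dw.
  have [r' r'0 rD] := open_has_rball Do Dw.
  apply/nbhs_rnormP; exists (Num.min r r'); first by rewrite lt_min r0.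
  by move=> w'; rewrite lt_min => /andP[/rA h /rD Dw']; split=> // /h.
have cE : connected_component D x `&` A = connected_component D x.
  apply: (@component_connected _ D x).
  - by exists x; split; [exact: connected_component_refl|exists 0; exact: reach_refl].
  - by exists A.
  - exists (~` (D `\` A)); first exact: open_closedC.
    apply/seteqP; split=> w [cw Aw]; split=> //; first by case.
    by apply: contrapT => nA; apply: Aw; split=> //; exact: connected_component_sub cw.
by move: Dxy; rewrite -cE => -[].
Qed.

(** When no chain joins x to y the value is 0, which is why most lemmas below ask
    for x and y in one component. *)
Definition pathdist D x y : R := inf [set l | reach D x y l].

Lemma pathdist_le D x y l : reach D x y l -> pathdist D x y <= l.
Proof. by move=> xy; apply: ge_inf => //; exists 0 => r /reach_ge0. Qed.

Lemma pathdist_ge D x y c : open D -> connected_component D x y ->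
  (forall l, reach D x y l -> c <= l) -> c <= pathdist D x y.
Proof.
move=> Do /(component_reach Do)[l xy] H; apply: lb_le_inf; first by exists l.
by move=> r /H.
Qed.

Lemma pathdist_ge0 D x y : open D -> connected_component D x y -> 0 <= pathdist D x y.
Proof. by move=> Do xy; apply: pathdist_ge => // l /reach_ge0. Qed.

Lemma pathdist_adherent D x y e : open D -> connected_component D x y -> 0 < e ->
  exists2 l, reach D x y l & l < pathdist D x y + e.
Proof.
move=> Do /(component_reach Do)[l xy] e0; apply: inf_adherent => //.
by split; [exists l|exists 0 => r /reach_ge0].
Qed.

Lemma pathdist_sym D x y : pathdist D x y = pathdist D y x.
Proof. by congr inf; apply/seteqP; split=> l; exact: reach_sym. Qed.

Lemma pathdist_triangle D x y z : open D -> connected_component D x y ->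
  connected_component D y z -> pathdist D x z <= pathdist D x y + pathdist D y z.
Proof.
move=> Do xy yz; apply/ler_addgt0Pr => e e0.
have e2 : 0 < e / 2 by rewrite divr_gt0.
have [l1 h1 l1e] := pathdist_adherent Do xy e2.
have [l2 h2 l2e] := pathdist_adherent Do yz e2.
have := pathdist_le (reach_cat h1 h2); lra.
Qed.

Lemma pathdist_refl D x : D x -> pathdist D x x = 0.
Proof.
move=> Dx; apply/eqP; rewrite eq_le; apply/andP; split.
  by apply: pathdist_le; exact: reach_refl.
by apply: lb_le_inf; [exists 0; exact: reach_refl|move=> l /reach_ge0].
Qed.

(** The modulus as a hyperbolic tangent, so that every point of the unit disc lies
    on a radius parametrized by tanh. *)
Lemma polarP (z : C) : normc z < 1 ->
  exists u l, [/\ normc u <= 1, 0 <= l, z = u * (tanh l)%:C & tanh l = normc z].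
Proof.
move=> z1; have z0 := normc_ge0 z.
have tl := @tanh_artanh _ (normc z) ltac:(lra).
have l0 : 0 <= artanh (normc z) by rewrite -tanh_ge0 tl.
have [->|zn] := eqVneq z 0.
  exists 1, 0; rewrite ComplexField.Normc.normc1 ComplexField.Normc.normc0 tanh0.
  by rewrite mulr0 lexx.
have n0 : 0 < normc z by rewrite normc_gt0.
exists (z / (normc z)%:C), (artanh (normc z)); split=> //.
  by rewrite normcM normcV normc_real ger0_norm // mulfV // lt0r_neq0.
rewrite tl divfK //; apply/eqP => /complexI /eqP; exact/negP/lt0r_neq0.
Qed.

Lemma reach_disc_any D phi (z : C) : holomorphic_disc D phi -> normc z < 1 ->
  exists2 l, reach D (phi 0) (phi z) l & tanh l = normc z.
Proof.
move=> phiD /polarP[u [l [u1 l0 zE tl]]]; exists l => //.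
have := reach_disc (holomorphic_disc_scale phiD u1) l0.
by rewrite mulr0 zE.
Qed.

Lemma disc_in_component D phi x : holomorphic_disc D phi ->
  connected_component D x (phi 0) -> holomorphic_disc (connected_component D x) phi.
Proof.
move=> phiD x0; apply/holomorphic_discP => z z1; split.
  have [l /reach_component h _] := reach_disc_any phiD z1.
  exact: connected_component_trans h.
by move/holomorphic_discP : phiD => /(_ z z1)[].
Qed.

Lemma lempert_tilde_ge0 D x y : (0 <= lempert_tilde D x y)%E.
Proof.
by apply: le_ereal_inf_tmp => _ [a _ <-]; rewrite lee_fin normc_ge0.
Qed.

Lemma lempert_disc_le D phi l : holomorphic_disc D phi -> 0 <= l ->
  (lempert D (phi 0%R) (phi (tanh l)%:C) <= l%:E)%E.
Proof.
move=> phiD l0; rewrite /lempert.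
have := lempert_tilde_ge0 D (phi 0) (phi (tanh l)%:C).
have : (lempert_tilde D (phi 0%R) (phi (tanh l)%:C) <= (tanh l)%:E)%E.
  apply: ereal_inf_lbound; exists (tanh l)%:C.
    split; last by exists phi.
    by rewrite normC_normc ltcR normc_tanh_lt1.
  by rewrite normc_real ger0_norm // tanh_ge0.
case: (lempert_tilde _ _ _) => [r| |] //=; rewrite !lee_fin => rl r0.
have l1 := tanh_lt1 l.
by rewrite -ler_tanh tanh_artanh //; lra.
Qed.

(** Comparing hyperbolic tangents avoids taking the infimum through artanh. *)
Lemma pathdist_le_lempert D D0 x y : D0 `<=` D -> ((pathdist D x y)%:E <= lempert D0 x y)%E.
Proof.
move=> D0D; rewrite /lempert; have := lempert_tilde_ge0 D0 x y.
case E : (lempert_tilde _ _ _) => [r| |] //=; last by move=> _; rewrite leey.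
rewrite !lee_fin => r0; rewrite leNgt; apply/negP => rr.
have [_ [a [a1 [phi [phiD pz pw]]] <-] ar] : exists2 q : \bar R,
    [set (normc alpha)%:E | alpha in [set alpha : C | `|alpha| < 1 /\
    exists phi, [/\ holomorphic_disc D0 phi, phi 0 = x & phi alpha = y]]] q &
    (q < +oo)%E.
  by apply: ereal_inf_lt; rewrite -/(lempert_tilde D0 x y) E ltry.
have r1 : r < 1.
  apply: (@le_lt_trans _ _ (normc a)); last first.
    by move: a1; rewrite normC_normc (ltcR (normc a) 1).
  by rewrite -lee_fin -E; apply: ereal_inf_lbound; exists a => //; split=> //; exists phi.
have tr := @tanh_artanh _ r ltac:(lra).
have : (lempert_tilde D0 x y < (tanh (pathdist D x y))%:E)%E.
  by rewrite E lte_fin -tr ltr_tanh.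
move=> /ereal_inf_lt[_ [b [b1 [psi [psiD pz' pw']]] <-]]; rewrite lte_fin.
have psiD' : holomorphic_disc D psi by move=> z /psiD[/D0D].
have b1' : normc b < 1 by move: b1; rewrite normC_normc (ltcR (normc b) 1).
have [l] := reach_disc_any psiD' b1'.
rewrite pz' pw' => /pathdist_le h <-; rewrite ltr_tanh; lra.
Qed.

(** The infimum over chains is a pseudodistance not exceeding the Lempert
    function, and any other one is at most the length of each chain, as the
    triangle inequality shows piece by piece. *)
Lemma kobayashiE D x y : open D -> connected_component D x y ->
  kobayashi D x y = (pathdist D x y)%:E.
Proof.
move=> Do xy; rewrite /kobayashi /kobayashi_domain; set D0 := connected_component D x.
have Dx : D x by apply: contrapT => /connected_component_out Dx; rewrite Dx in xy.
have D0x : D0 x by exact: connected_component_refl.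
have D0D : D0 `<=` D by exact: connected_component_sub.
have D0c z w : D0 z -> D0 w -> connected_component D z w.
  by move=> /connected_component_sym; exact: connected_component_trans.
apply/eqP; rewrite eq_le; apply/andP; split; last first.
  apply: ereal_sup_ubound; exists (pathdist D) => //; split; last first.
    by move=> z w _ _; exact: pathdist_le_lempert.
  split.
  - by move=> z /D0D; exact: pathdist_refl.
  - by move=> z w z0 w0; apply: pathdist_ge0 => //; exact: D0c.
  - by move=> z w _ _; exact: pathdist_sym.
  - by move=> u v w u0 v0 w0; apply: pathdist_triangle => //; exact: D0c.
apply: ge_ereal_sup => _ [d [[d1 d2 d3 d4] dl] <-]; rewrite lee_fin.
apply: pathdist_ge => // l [g gL [g0 gl]].
have := @chain_rel _ _ (fun z w l => D0 z -> D0 w /\ d z w <= l) D setT 1 ltr01 _ _ _ _ gL 0 l.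
rewrite g0 gl subr0 lexx (chain_ge0 gL) => H; apply: (H _ _ _ _ _ _ D0x).2 => //.
- move=> u v w l1 l2 uv vw u0; have [v0 h1] := uv u0; have [w0 h2] := vw v0.
  by split=> //; apply: le_trans (d4 _ _ _ u0 v0 w0) _; exact: lerD.
- move=> phi l' phiD _ l'0 _ p0.
  have phiD0 : holomorphic_disc D0 phi by exact: disc_in_component.
  have p1 : D0 (phi (tanh l')%:C).
    exact: (connected_component_trans p0 (reach_component (reach_disc phiD l'0))).
  split=> //; rewrite -lee_fin; apply: le_trans (dl _ _ p0 p1) _.
  exact: lempert_disc_le.
Qed.

Import HBNNSimple.

Lemma kobayashi_royden_ge0 D x v : (0 <= kobayashi_royden D x v)%E.
Proof.
by apply: le_ereal_inf_tmp => _ [a _ <-]; rewrite lee_fin normc_ge0.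
Qed.

(** The integrand is not known to be measurable, and its integral is a supremum
    over simple functions below it; each of these is at most 1 off a null set. *)
Lemma integral_le_length (F : R -> \bar R) (S : seq R) t1 t2 : t1 <= t2 ->
  (forall t, 0 <= F t)%E -> (forall t, (t1 <= t <= t2)%R -> t \notin S -> F t <= 1)%E ->
  (\int[lebesgue_measure]_(t in `[t1, t2]) F t <= (t2 - t1)%:E)%E.
Proof.
move=> t12 F0 F1.
rewrite ge0_integralE; last by move=> t _.
apply: ge_ereal_sup => _ [h hF <-].
rewrite -integralT_nnsfun.
have mu12 : lebesgue_measure (`[t1, t2]%classic : set R) = (t2 - t1)%:E.
  rewrite lebesgue_measure_itv /= lte_fin; case: ifPn => [_|].
    by rewrite EFinB.
  rewrite -leNgt => t21; have -> : t1 = t2 by lra.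
  by rewrite subrr.
rewrite -mu12 -[X in (_ <= lebesgue_measure X)%E]setIT -integral_indic //.
apply: ae_ge0_le_integral => //.
- by move=> t _; rewrite lee_fin; exact: fun_ge0.
- exact/measurable_EFinP.
- by apply/measurable_EFinP; exact: measurable_indic.
exists [set` S]; split.
- apply: countable_measurable; last by apply: finite_set_countable; exact: finite_seq.
  by move=> t; exact: measurable_set1.
- by apply: countable_lebesgue_measure0; apply: finite_set_countable; exact: finite_seq.
move=> t /= tN; apply: contrapT => tS; apply: tN => _.
apply: le_trans (hF t) _; rewrite /patch indicE.
case: ifPn => // tI; apply: F1; last exact/negP.
by move: tI; rewrite inE /= in_itv.
Qed.

Lemma kr_length_le D L g t1 t2 : chain D L g -> 0 <= t1 -> t1 <= t2 -> t2 <= L ->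
  (kr_length D g t1 t2 <= (t2 - t1)%:E)%E.
Proof.
move=> /chain_speed[S gS] t10 t12 t2L.
apply: (@integral_le_length _ S) => //; first by move=> t; exact: kobayashi_royden_ge0.
move=> t t12' tS; apply: unit_speed_velocity; apply: gS => //; lra.
Qed.

Lemma chain_ac D L g : chain D L g -> absolutely_continuous_on 0 L g.
Proof.
move=> /chain_lipschitz[K K0 gK] e e0; have K1 : 0 < K + 1 by lra.
exists (e / (K + 1)); first by rewrite divr_gt0.
move=> m s t st _; rewrite ltr_pdivlMr // => sume.
have -> : \sum_(i < m) `|g (t i) - g (s i)| = (\sum_(i < m) rnorm (g (t i) - g (s i)))%:C.
  by rewrite rmorph_sum /=; apply: eq_bigr => i _; rewrite normE.
rewrite ltcR; apply: le_lt_trans sume.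
rewrite mulr_suml; apply: ler_sum => i _; have [s0 sti tL] := st i.
have := gK (s i) (t i) s0 sti tL; nra.
Qed.

(** Near-minimality on the whole chain passes to each stretch [t1, t2], since the
    distances over [0, t1] and [t2, L] are at most t1 and L - t2. *)
Lemma chain_geodesic D (lambda eps : R) L g : open D -> 1 <= lambda -> chain D L g ->
  L <= pathdist D (g 0) (g L) + eps -> geodesic D lambda eps 0 L g.
Proof.
move=> Do l1 gL Lr; have L0 := chain_ge0 gL; split=> //.
- exact: chain_ac gL.
- by move=> t tL; exact: (chain_in gL tL).
move=> t1 t2 t10 t12 t2L.
have r1 := chain_reach gL (lexx 0) t10 (le_trans t12 t2L).
have r2 := chain_reach gL t10 t12 t2L.
have r3 := chain_reach gL (le_trans t10 t12) t2L (lexx L).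
have c1 := reach_component r1; have c2 := reach_component r2.
have c3 := reach_component r3.
apply: le_trans (kr_length_le gL t10 t12 t2L) _.
rewrite kobayashiE // -EFinM -EFinD lee_fin.
have h1 := pathdist_le r1; have h3 := pathdist_le r3.
have h4 := pathdist_triangle Do c1 (connected_component_trans c2 c3).
have h5 := pathdist_triangle Do c2 c3.
have h6 := pathdist_ge0 Do c2.
have : pathdist D (g t1) (g t2) <= lambda * pathdist D (g t1) (g t2) by rewrite ler_peMl.
lra.
Qed.

(** Every pair of points is joined by near-geodesics, so the visibility hypothesis
    is never vacuous; they come with their length as chains. *)
Lemma almost_geodesic D (lambda eps : R) x y : open D -> 1 <= lambda -> 0 < eps ->
  connected_component D x y ->
  exists L g, [/\ chain D L g, geodesic D lambda eps 0 L g, g 0 = x, g L = y &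
    L <= pathdist D x y + eps].
Proof.
move=> Do l1 eps0 xy; have [L [g gL [g0 gLy]] Lr] := pathdist_adherent Do xy eps0.
exists L, g; split=> //; last exact: ltW.
by apply: chain_geodesic => //; rewrite g0 gLy ltW.
Qed.

End Distance.

(** * Leaving a ball *)

Section Localization.
Context {R : realType} {n : nat}.
Local Notation C := R[i].
Local Notation V := 'rV[R[i]]_n.
Local Notation normc := (@ComplexField.Normc.normc R).
Implicit Types (D W U B K Omega : set V) (phi : C -> V) (g : R -> V) (s t L l r c : R) (x y z p : V).

Lemma rball_open p r : open [set y : V | rnorm (y - p) < r].
Proof.
move=> y /= yp; apply/nbhs_rnormP; exists (r - rnorm (y - p)); first by rewrite subr_gt0.
move=> w wy; have := ler_rdistD y w p; rewrite /=; lra.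
Qed.

Lemma rball_closure p r : closure [set y : V | rnorm (y - p) < r] `<=`
  [set y | rnorm (y - p) <= r].
Proof.
move=> x xA; apply: (@closed_rball R _ p r) => B /xA[y [/= yA yB]].
by exists y; split=> //=; exact: ltW.
Qed.

Lemma rball_relatively_compact p r U : [set y : V | rnorm (y - p) <= r] `<=` U ->
  relatively_compact [set y | rnorm (y - p) < r] U.
Proof.
move=> rU; split; last exact: subset_trans (@rball_closure p r) rU.
apply: (subclosed_compact _ (@compact_rball R n p r)); first exact: closed_closure.
exact: rball_closure.
Qed.

Lemma bounded_rnormP D : bounded_set D <-> exists M : R, forall x, D x -> rnorm x <= M.
Proof.
split=> [[M [Mr MP]]|[M MP]].
  exists (complex.Re M + 1) => x Dx.
  have [a aE] := complex_realP _ Mr.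
  have := MP (complex.Re M + 1)%:C; rewrite aE ltcR /= ltrDl => /(_ ltr01 x Dx).
  by rewrite normE lecR.
exists M%:C; split; first by apply/complex_realP; exists M.
move=> N MN x Dx /=; rewrite normE; apply: le_trans (ltW MN).
by rewrite lecR; exact: MP.
Qed.

Lemma rball_bounded p r : bounded_set [set y : V | rnorm (y - p) < r].
Proof.
apply/bounded_rnormP; exists (r + rnorm p) => y /= yp.
by rewrite -[y](subrK p); apply: le_trans (ler_rnormD _ _) _; rewrite lerD2r ltW.
Qed.

(** The exit time is the infimum of the times spent outside of the open ball; up to
    that time the closed ball is not left, which is what localization needs. *)
Lemma chain_first_exit D L g p r : chain D L g -> rnorm (g 0 - p) < r ->
  ~ (forall t, 0 <= t <= L -> rnorm (g t - p) < r) ->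
  exists t1, [/\ 0 <= t1 <= L, r <= rnorm (g t1 - p) &
    forall u, 0 <= u <= t1 -> rnorm (g u - p) <= r].
Proof.
move=> gL g0 gout; have [K K0 gK] := chain_lipschitz gL.
pose f t := rnorm (g t - p).
have fK s t : 0 <= s -> s <= t -> t <= L -> f t <= f s + K * (t - s) /\ f s <= f t + K * (t - s).
  move=> s0 st tL; have := gK s t s0 st tL; rewrite /f.
  have := ler_rdistD (g s) (g t) p; have := ler_rdistD (g t) (g s) p.
  by rewrite (rnormB (g s) (g t)); split; lra.
pose E := [set t | 0 <= t <= L /\ r <= f t].
have Eb : has_inf E.
  split; last by exists 0 => t [/andP[]].
  apply: contrapT => E0; apply: gout => t tL; rewrite ltNge; apply/negP => rt.
  by apply: E0; exists t.
pose t1 := inf E.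
have t10 : 0 <= t1 by apply: lb_le_inf; [exact: Eb.1|move=> t [/andP[]]].
have t1E t : E t -> t1 <= t by move=> Et; apply: ge_inf => //; exact: Eb.2.
have t1L : t1 <= L by have [t Et] := Eb.1; apply: le_trans (t1E _ Et) _; case: Et => /andP[].
have K1 : 0 < K + 1 by lra.
have rt1 : r <= f t1.
  rewrite leNgt; apply/negP => ft1.
  have d0 : 0 < (r - f t1) / (K + 1) by rewrite divr_gt0 ?subr_gt0.
  have [t Et] := inf_adherent d0 Eb; rewrite -/t1 => tt1.
  have t1t := t1E _ Et; case: Et => /andP[_ tL] rt.
  have := (fK _ _ t10 t1t tL).1.
  have : (t - t1) * (K + 1) < r - f t1 by rewrite -ltr_pdivlMr //; lra.
  nra.
exists t1; split=> //; first by rewrite t10.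
move=> u /andP[u0 ut1].
have before v : 0 <= v -> v < t1 -> f v < r.
  move=> v0 vt1; rewrite ltNge; apply/negP => rv.
  have : t1 <= v by apply: t1E; split=> //; lra.
  lra.
move: ut1; rewrite le_eqVlt => /orP[/eqP ->|ut]; last by apply: ltW; exact: before.
rewrite leNgt; apply/negP => ft1; rewrite -/(f t1) in ft1.
have t1p : 0 < t1.
  rewrite lt0r t10 andbT; apply/eqP => t1z; move: ft1; rewrite t1z /f; lra.
pose v := Num.max 0 (t1 - (f t1 - r) / (K + 1)).
have d0 : 0 < (f t1 - r) / (K + 1) by rewrite divr_gt0 ?subr_gt0.
have v0 : 0 <= v by rewrite le_max lexx.
have vt1 : v < t1 by rewrite gt_max t1p ltrBlDr ltrDl.
have dv : t1 - v <= (f t1 - r) / (K + 1).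
  have : t1 - (f t1 - r) / (K + 1) <= v by rewrite le_max lexx orbT.
  lra.
have := (fK _ _ v0 (ltW vt1) t1L).1; have := before _ v0 vt1.
have : (t1 - v) * (K + 1) <= f t1 - r by rewrite -ler_pdivlMr.
nra.
Qed.

(** * Localization near the boundary point *)

(** Royden's localization condition: discs of Omega centered in B are carried into U
    by a uniform contraction of the parameter. *)
Definition localized Omega B U c := [/\ 0 < c, c <= 1 &
  forall phi, holomorphic_disc Omega phi -> B (phi 0) ->
    forall z : C, normc z < c -> U (phi z)].

(** Shrinking a disc of Omega by the factor tanh l / tanh (6 l / c), which is at
    most c, gives a disc in U that reaches the same point at parameter 6 l / c. *)
Lemma localized_reach Omega B U c L g s t : localized Omega B U c ->
  chain Omega L g -> 0 <= s -> s <= t -> t <= L ->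
  (forall u, s <= u <= t -> B (g u)) ->
  reach (Omega `&` U) (g s) (g t) (6 / c * (t - s)).
Proof.
move=> [c0 c1 cU] gL s0 st tL gB.
have c12 : 0 < c / 12 by rewrite divr_gt0.
apply: (@chain_rel _ _ (fun x y l => reach (Omega `&` U) x y (6 / c * l)) Omega B
   (c / 12) c12 _ _ _ _ gL) => //.
  by move=> x y z l l' xy yz; rewrite mulrDr; exact: reach_cat yz.
move=> phi l phiO phiB l0 lc.
have [->|ln] := eqVneq l 0.
  rewrite mulr0 tanh0; apply: reach_refl; split; last first.
    by apply: cU => //; rewrite ComplexField.Normc.normc0.
  by move/holomorphic_discP : phiO => /(_ 0); rewrite ComplexField.Normc.normc0 => -[].
have {ln}lp : 0 < l by rewrite lt0r ln.
set l' := 6 / c * l.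
have l'c : l' * c = 6 * l by rewrite /l'; field; rewrite lt0r_neq0.
have l'0 : 0 < l' by rewrite mulr_gt0 // divr_gt0.
have l'2 : l' <= 2^-1 by rewrite -(ler_pM2r c0) l'c; lra.
have th := @tanh_ge3 _ l' ltac:(lra).
have tl := tanh_le2 l0.
have tl0 : 0 < tanh l by rewrite -(@tanh0 R) ltr_tanh.
have tl'0 : 0 < tanh l' by lra.
pose k := tanh l / tanh l'.
have k0 : 0 < k by rewrite divr_gt0.
have kc : k <= c by rewrite ler_pdivrMr //; nra.
have kE : k%:C * (tanh l')%:C = (tanh l)%:C :> C by rewrite -rmorphM /k divfK // lt0r_neq0.
have kO : holomorphic_disc Omega (fun z : C => phi (k%:C * z)).
  by apply: holomorphic_disc_scale => //; rewrite normc_real gtr0_norm // (le_trans kc).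
have kOU : holomorphic_disc (Omega `&` U) (fun z : C => phi (k%:C * z)).
  apply/holomorphic_discP => z z1; move/holomorphic_discP : kO => /(_ z z1)[h1 h2].
  split=> //; split=> //; apply: cU => //.
  rewrite normcM normc_real gtr0_norm //; have := normc_ge0 z; nra.
by have := reach_disc kOU (ltW l'0); rewrite mulr0 kE.
Qed.

Lemma reach_short D x e : open D -> D x -> 0 < e ->
  \forall y \near x, exists2 l, reach D x y l & l <= e.
Proof.
move=> Do Dx e0; have [r r0 rD] := open_has_rball Do Dx.
apply/nbhs_rnormP; exists (Num.min (r / 12) (e * r / 6)).
  by rewrite lt_min !divr_gt0 // mulr_gt0.
move=> y; rewrite lt_min => /andP[y1 y2].
exists (6 * rnorm (y - x) / r); first by apply: reach_near => //; exact: ltW.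
by rewrite ler_pdivrMr //; lra.
Qed.

(** The bound is found for one variable at a time; a compact set may meet several
    components, so only pairs in one component are compared. *)
Lemma pathdist_compact_bound D K : open D -> compact K -> K `<=` D ->
  exists M, forall y y', K y -> K y' -> connected_component D y y' -> pathdist D y y' <= M.
Proof.
move=> Do Kc KD.
have step y : K y -> exists M, forall y', K y' -> connected_component D y y' -> pathdist D y y' <= M.
  move=> Ky; apply: (@compact_uniform _ _ K
    (fun M y' => connected_component D y y' -> pathdist D y y' <= M) Kc).
    by move=> M M' y' MM' h /h /le_trans; apply.
  move=> x Kx; exists (pathdist D y x + 1).
  have := reach_short Do (KD _ Kx) ltr01.
  apply: filterS => x' xx' yx'.
  have [l xl l1] := xx'.
  have yx : connected_component D y x.
    exact: connected_component_trans yx' (connected_component_sym (reach_component xl)).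
  have := pathdist_triangle Do yx (reach_component xl); have := pathdist_le xl; lra.
have [|M MP] := @compact_uniform R _ K
    (fun M y => forall y', K y' -> connected_component D y y' -> pathdist D y y' <= M) Kc
    (fun M M' x MM' h y' Ky' xy' => le_trans (h y' Ky' xy') MM').
  move=> x Kx; have [M xM] := step x Kx; exists (M + 1).
  have := reach_short Do (KD _ Kx) ltr01.
  apply: filterS => x' xx' y' Ky' x'y'.
  have [l xl l1] := xx'.
  have x'x := reach_component (reach_sym xl).
  have xy' := connected_component_trans (reach_component xl) x'y'.
  have := pathdist_triangle Do x'x xy'; have := pathdist_le (reach_sym xl).
  have := xM _ Ky' xy'; lra.
by exists M => y y' Ky; exact: MP.
Qed.

Lemma geodesic_restrict D lambda e e' a b b' g : a <= b' -> b' <= b -> e <= e' ->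
  geodesic D lambda e a b g -> geodesic D lambda e' a b' g.
Proof.
move=> ab' b'b ee' [ab gac gD gl]; split=> //.
- move=> d /gac[d' d'0 H]; exists d' => // m s t st; apply: H => i.
  by have [h1 h2 h3] := st i; split=> //; exact: le_trans b'b.
- by move=> t /andP[at' tb']; apply: gD; rewrite at' (le_trans tb').
- move=> t1 t2 at1 t12 t2b'; apply: le_trans (gl _ _ at1 t12 (le_trans t2b' b'b)) _.
  by apply: leeD2l; rewrite lee_fin.
Qed.

Lemma domain_component D x y : domain D -> D x -> D y -> connected_component D x y.
Proof. by move=> [_ _ Dc] Dx Dy; exact: (connected_component_max Dx _ Dc). Qed.

(** The core of the theorem.  The last hypothesis is the form in which visibility is
    used: a near-geodesic chain that starts near p and reaches the sphere of
    radius r at time t1 gives access from its origin to K inside D, at a cost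
    affine in t1.  The additive constants are absorbed because a chain that
    leaves the ball has length at least c'. *)
Lemma comparison_of_exits Omega U K p (lambda r r' c c' A' B' : R) :
  domain Omega -> hyperbolic Omega -> open U -> 1 <= lambda ->
  r' <= r -> [set y | rnorm (y - p) <= r] `<=` U ->
  localized Omega [set y | rnorm (y - p) <= r] U c ->
  0 < c' -> (forall z x, Omega z -> rnorm (z - p) < r' -> Omega x ->
     r <= rnorm (x - p) -> c' <= pathdist Omega z x) ->
  compact K -> K `<=` Omega `&` U -> 0 <= A' -> 0 <= B' ->
  (forall L g t1, chain Omega L g -> 0 <= t1 <= L -> geodesic Omega lambda 1 0 t1 g ->
     rnorm (g 0 - p) < r' -> r <= rnorm (g t1 - p) ->
     (forall u, 0 <= u <= t1 -> rnorm (g u - p) <= r) ->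
     exists y l, [/\ K y, reach (Omega `&` U) (g 0) y l & l <= A' * t1 + B']) ->
  exists2 C0 : R, 1 <= C0 & forall z w, Omega z -> rnorm (z - p) < r' ->
    Omega w -> rnorm (w - p) < r' -> connected_component (Omega `&` U) z w ->
    pathdist (Omega `&` U) z w <= C0 * pathdist Omega z w.
Proof.
move=> Od Oh Uo l1 rr' rU cloc c'0 c'P Kc KOU A'0 B'0 exitP.
have [_ Oo _] := Od.
have Do : open (Omega `&` U) by exact: openI.
have [M MP] := pathdist_compact_bound Do Kc KOU.
have c0 : 0 < 6 / c by have [? _ _] := cloc; rewrite divr_gt0.
have half z w : Omega z -> rnorm (z - p) < r' -> Omega w -> z <> w ->
    (exists2 l, reach (Omega `&` U) z w l & l <= 12 / c * pathdist Omega z w) \/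
    (c' <= 2 * pathdist Omega z w /\
     exists y l, [/\ K y, reach (Omega `&` U) z y l & l <= A' * 2 * pathdist Omega z w + B']).
  move=> Oz zV Ow zw.
  have zwc := domain_component Od Oz Ow.
  have rho0 : 0 < pathdist Omega z w.
    rewrite lt0r pathdist_ge0 // andbT; apply/eqP => e0; apply: zw; apply: Oh => //.
    by rewrite kobayashiE // e0.
  (* at most 1 for visibility, at most the distance for a multiplicative error *)
  have e0 : 0 < Num.min 1 (pathdist Omega z w) by rewrite lt_min ltr01.
  have [L [g [gL gg g0 gw Lr]]] := almost_geodesic Oo l1 e0 zwc.
  have L0 := chain_ge0 gL.
  have L2 : L <= 2 * pathdist Omega z w.
    apply: le_trans Lr _; have : Num.min 1 (pathdist Omega z w) <= pathdist Omega z w.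
      by rewrite ge_min lexx orbT.
    lra.
  have [gin|gout] := EM (forall t, 0 <= t <= L -> rnorm (g t - p) < r).
    left; exists (6 / c * (L - 0)).
      rewrite -g0 -gw; apply: (localized_reach cloc gL) => //.
      by move=> u /gin /ltW.
    rewrite subr0; have : 6 / c * L <= 6 / c * (2 * pathdist Omega z w) by rewrite ler_pM2l.
    lra.
  right; have [|t1 [/andP[t10 t1L] t1r t1in]] := chain_first_exit gL _ gout.
    by rewrite g0; lra.
  have zt1 : c' <= t1.
    have := chain_reach gL (lexx 0) t10 t1L; rewrite g0 subr0 => /pathdist_le; apply: le_trans.
    by apply: c'P => //; apply: (chain_in gL); rewrite t10.
  split; first by lra.
  have gg1 : geodesic Omega lambda 1 0 t1 g.
    by apply: (geodesic_restrict t10 t1L _ gg); rewrite ge_min lexx.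
  have g0V : rnorm (g 0 - p) < r' by rewrite g0.
  have t1i : 0 <= t1 <= L by rewrite t10.
  have [y [l [Ky zy lt]]] := exitP L g t1 gL t1i gg1 g0V t1r t1in.
  exists y, l; split=> //; first by rewrite -g0.
  have : A' * t1 <= A' * (2 * pathdist Omega z w) by rewrite ler_wpM2l //; lra.
  lra.
have M' : 0 <= Num.max M 0 by rewrite le_max lexx orbT.
pose C0 := 1 + 12 / c + 4 * A' + (2 * B' + Num.max M 0) * (2 / c').
have Bc : 0 <= (2 * B' + Num.max M 0) * (2 / c').
  by rewrite mulr_ge0 ?divr_ge0 ?addr_ge0 ?mulr_ge0 // ltW.
have c12 : 0 <= 12 / c by have -> : 12 / c = 2 * (6 / c); [ring|lra].
exists C0; first by rewrite /C0; lra.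
move=> z w Oz zV Ow wV zwU.
have [<-|/eqP zw] := eqVneq z w.
  rewrite !pathdist_refl ?mulr0 //; split=> //; apply: rU => /=; lra.
have zwc := domain_component Od Oz Ow.
have rho0 := pathdist_ge0 Oo zwc.
have [[l zl lr]|[c'r [y [l [Ky zy ly]]]]] := half z w Oz zV Ow zw.
  apply: le_trans (pathdist_le zl) _; apply: le_trans lr _; apply: ler_wpM2r => //.
  by rewrite /C0; lra.
have [[l' wl lr]|[_ [y' [l' [Ky' wy' ly']]]]] := half w z Ow wV Oz (fun e => zw (esym e)).
  rewrite pathdist_sym; apply: le_trans (pathdist_le wl) _; apply: le_trans lr _.
  by rewrite pathdist_sym; apply: ler_wpM2r => //; rewrite /C0; lra.
have zyc := reach_component zy; have wyc := reach_component wy'.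
have yy' : connected_component (Omega `&` U) y y'.
  apply: connected_component_trans (connected_component_sym zyc) _.
  exact: connected_component_trans zwU wyc.
have h1 := pathdist_triangle Do zyc yy'.
have h2 := pathdist_triangle Do (connected_component_trans zyc yy') (connected_component_sym wyc).
have h3 := MP _ _ Ky Ky' yy'.
have h4 : M <= Num.max M 0 by rewrite le_max lexx.
have h5 := pathdist_le zy; have h6 := pathdist_le (reach_sym wy').
rewrite (pathdist_sym Omega w z) in ly'.
have h7 : (2 * B' + Num.max M 0) <= (2 * B' + Num.max M 0) * (2 / c') * pathdist Omega z w.
  rewrite -mulrA; apply: ler_peMr; first lra.
  by rewrite mulrAC ler_pdivlMr // mul1r.
rewrite /C0; nra.
Qed.

(** * Domains hyperbolic at the point *)

(** Points far away are at a definite Lempert distance from the points near p, so a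
    disc centered near p cannot get there within a small parameter disc. *)
Lemma hyperbolic_at_bounded Omega p : hyperbolic_at Omega p ->
  exists r d M : R, [/\ 0 < r, 0 < d, d <= 1 & forall phi, holomorphic_disc Omega phi ->
    rnorm (phi 0 - p) < r -> forall z : C, normc z < d -> rnorm (phi z) <= M].
Proof.
case=> [/bounded_rnormP[M MP]|[_]].
  exists 1, 1, M; split=> // phi /holomorphic_discP phiD _ z z1.
  by apply: MP; exact: (phiD z z1).1.
rewrite limf_einfE => /ereal_sup_gt[_ [X [[P Q] [/= Pp [M _ MQ]] PQX] <-]] infX.
have [r r0 rP] := (nbhs_rnormP p _).1 Pp.
have [d d0 dX] : exists2 d : R, 0 < d & forall v, X v -> (d%:E <= lempert Omega v.1 v.2)%E.
  move: infX; case E : (ereal_inf _) => [d| |] //.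
    rewrite lte_fin => d0; exists d => // v Xv; rewrite -E.
    by apply: ereal_inf_lbound; exists v.
  move=> _; exists 1 => // v Xv; apply: (@le_trans _ _ +oo%E); first exact: leey.
  by rewrite -E; apply: ereal_inf_lbound; exists v.
exists r, (tanh d), M; split=> //.
- by rewrite -(@tanh0 R) ltr_tanh.
- exact/ltW/tanh_lt1.
move=> phi phiD p0 z zd; rewrite leNgt; apply/negP => Mz.
have z1 : normc z < 1 by apply: lt_trans zd (tanh_lt1 _).
have /holomorphic_discP phiD' := phiD.
have [u [l [u1 l0 zE tl]]] := polarP z1.
have Xz : X (phi 0, phi z).
  apply: PQX; split => /=.
    by apply: rP => //; apply: (phiD' 0 _).1; rewrite ComplexField.Normc.normc0.
  by apply: MQ; [rewrite /= normE ltcR|exact: (phiD' z z1).1].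
have := dX _ Xz => /=.
have := lempert_disc_le (holomorphic_disc_scale phiD u1) l0; rewrite mulr0 -zE => h1 h2.
have := le_trans h2 h1; rewrite lee_fin leNgt => /negP; apply.
by rewrite -ltr_tanh tl.
Qed.

(** Cauchy's estimate applied to the uniformly bounded discs. *)
Lemma hyperbolic_at_lipschitz Omega p : hyperbolic_at Omega p ->
  exists r d K0 : R, [/\ 0 < r, 0 < d <= 1, 0 <= K0 & forall phi, holomorphic_disc Omega phi ->
    rnorm (phi 0 - p) < r -> forall z : C, normc z < d ->
    rnorm (phi z - phi 0) <= K0 * normc z].
Proof.
move=> /hyperbolic_at_bounded[r [d [M [r0 d0 d1 H]]]].
have d20 : 0 < d / 2 by rewrite divr_gt0.
exists r, (d / 2), (96 * `|M| / (d / 2)); split=> //.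
- by rewrite d20 /=; lra.
- by rewrite divr_ge0 ?mulr_ge0 // ltW.
move=> phi phiD p0 z zd.
have [u [l [u1 l0 zE tl]]] := @polarP _ z ltac:(lra).
have b (w : C) : normc w < d / 2 + d / 2 -> rnorm (phi (u * w)) <= `|M|.
  move=> wd; apply: le_trans (ler_norm M); apply: H => //; rewrite normcM.
  have := normc_ge0 w; have := normc_ge0 u; nra.
have := @disc_deriv_le _ _ Omega (fun w => phi (u * w)) (d / 2) (d / 2) `|M| (ltW d20) d20
  ltac:(lra) b (holomorphic_disc_scale phiD u1) 0 (tanh l) (lexx 0) _ _.
rewrite rmorph0 mulr0 -zE tl subr0; apply; [exact: normc_ge0|exact: ltW].
Qed.

(** Chains move at bounded Euclidean speed near p, so crossing the shell between
    the radii r1 and r2 takes time. *)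
Lemma pathdist_ge_lipschitz Omega p (r d K0 r1 r2 : R) : open Omega -> 0 < d -> 0 <= K0 ->
  (forall phi, holomorphic_disc Omega phi ->
    rnorm (phi 0 - p) < r -> forall z : C, normc z < d ->
    rnorm (phi z - phi 0) <= K0 * normc z) -> r1 <= r2 -> r2 < r ->
  forall z x, connected_component Omega z x -> rnorm (z - p) < r1 -> r2 <= rnorm (x - p) ->
  (r2 - r1) / (2 * K0 + 1) <= pathdist Omega z x.
Proof.
move=> Oo d0 K00 H r12 r2r z x zx zr xr.
apply: pathdist_ge => // l [g gL [g0 gl]].
have K1 : 0 < 2 * K0 + 1 by lra.
have l0 := chain_ge0 gL.
have [|gout|t1 [/andP[t10 t1l] rt1 t1in]] := @chain_first_exit _ _ _ p r2 gL.
- by rewrite g0; lra.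
- by have := gout l; rewrite l0 lexx gl => /(_ isT); lra.
rewrite ler_pdivrMr //; apply: (@le_trans _ _ ((2 * K0 + 1) * t1)); last by nra.
have d20 : 0 < d / 2 by rewrite divr_gt0.
have := @chain_rel _ _ (fun x y l => rnorm (y - x) <= (2 * K0 + 1) * l) Omega
  [set y | rnorm (y - p) < r] (d / 2) d20 _ _ _ _ gL 0 t1.
rewrite subr0 => G.
have : rnorm (g t1 - g 0) <= (2 * K0 + 1) * t1.
  apply: G => //.
  - move=> a b c k k' h1 h2; apply: le_trans (ler_rdistD b _ _) _; lra.
  - move=> phi k phiD p0 k0 kd.
    have tk := tanh_le2 k0; have tk0 : 0 <= tanh k by rewrite tanh_ge0.
    have nk : normc (tanh k)%:C = tanh k by rewrite normc_real ger0_norm.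
    have := H phi phiD p0 (tanh k)%:C; rewrite nk => /(_ ltac:(lra)); nra.
  - by move=> u /t1in /=; lra.
rewrite g0; have := ler_rdistD z (g t1) p; lra.
Qed.

(** Visibility is for D here: the chain of Omega up to its exit time is first
    localized, and a near-geodesic of D with the same endpoints meets K. *)
Theorem comparison_hyperbolic_at Omega U p (lambda : R) :
  domain Omega -> hyperbolic Omega -> open U -> U p -> 1 <= lambda ->
  visible (Omega `&` U) p lambda -> hyperbolic_at Omega p ->
  exists r', 0 < r' /\ [set y | rnorm (y - p) <= r'] `<=` U /\
  exists2 C0 : R, 1 <= C0 & forall z w, Omega z -> rnorm (z - p) < r' ->
    Omega w -> rnorm (w - p) < r' -> connected_component (Omega `&` U) z w ->
    pathdist (Omega `&` U) z w <= C0 * pathdist Omega z w.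
Proof.
move=> Od Oh Uo Up l1 vis /hyperbolic_at_lipschitz[r [d [K0 [r0 /andP[d0 d1] K00 H]]]].
have [_ Oo _] := Od.
have Do : open (Omega `&` U) by exact: openI.
have [rU rU0 rUU] := open_has_rball Uo Up.
pose r2 := Num.min r rU / 2.
have m0 : 0 < Num.min r rU by rewrite lt_min r0.
have mr : Num.min r rU <= r by rewrite ge_min lexx.
have mU : Num.min r rU <= rU by rewrite ge_min lexx orbT.
have r20 : 0 < r2 by rewrite divr_gt0.
have K1 : 0 < K0 + 1 by lra.
pose c := Num.min d (rU / 2 / (K0 + 1)).
have c0 : 0 < c by rewrite lt_min d0 !divr_gt0.
have cd : c <= d by rewrite ge_min lexx.
have cK : c * (K0 + 1) <= rU / 2 by rewrite -ler_pdivlMr // ge_min lexx orbT.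
have cloc : localized Omega [set y | rnorm (y - p) <= r2] U c.
  split=> // [|phi phiD /= p0 z zc]; first exact: le_trans d1.
  apply: rUU; have := H phi phiD ltac:(rewrite /r2 in p0; lra) z ltac:(lra).
  have := ler_rdistD (phi 0) (phi z) p; rewrite /r2 in p0.
  have := normc_ge0 z; nra.
have [W [K [Wo Wp _ [Kc KD] WK]]] := vis 1 ler01 _ (@rball_open p r2)
  ltac:(by rewrite /= subrr rnorm0) (@rball_bounded p r2).
have [rW rW0 rWW] := open_has_rball Wo Wp.
pose r' := Num.min rW (r2 / 2).
have r'0 : 0 < r' by rewrite lt_min rW0 divr_gt0.
have r'W : r' <= rW by rewrite ge_min lexx.
have r'2 : r' <= r2 / 2 by rewrite ge_min lexx orbT.
exists r'; split=> //; split.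
  by move=> y /= yr; apply: rUU; rewrite /r2 in r'2; lra.
apply: (@comparison_of_exits _ _ K p lambda r2 r' c ((r2 - r') / (2 * K0 + 1)) (6 / c) 1) => //.
- lra.
- by move=> y /= yr; apply: rUU; rewrite /r2 in yr; lra.
- by rewrite divr_gt0 //; lra.
- move=> z x Oz zr Ox xr.
  apply: (pathdist_ge_lipschitz Oo d0 K00 H _ _ _ zr xr); [lra|rewrite /r2; lra|].
  exact: domain_component.
- by rewrite divr_ge0 // ltW.
move=> L g t1 gL /andP[t10 t1L] _ g0 gt1 t1in.
have gr := localized_reach cloc gL (lexx 0) t10 t1L t1in; rewrite subr0 in gr.
have [L' [s [sL sg s0 sL' Ls]]] := almost_geodesic Do l1 ltr01 (reach_component gr).
have [||t /andP[t0 tL'] Kt] := WK _ _ _ sg.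
- by apply: rWW; rewrite s0; lra.
- by rewrite sL' /=; lra.
exists (s t), t; split=> //.
  by have := chain_reach sL (lexx 0) t0 tL'; rewrite s0 subr0.
have := pathdist_le gr; lra.
Qed.

(** * Visible points of the domain *)

(** On a small compact sphere around y the distance to y is positive and
    continuous, and chains that leave the ball cross the sphere. *)
Lemma pathdist_sphere_lower Omega y (r0 : R) : domain Omega -> hyperbolic Omega -> Omega y ->
  0 < r0 -> exists r m : R, [/\ 0 < r, r <= r0, 0 < m & forall z, Omega z ->
    r <= rnorm (z - y) -> m <= pathdist Omega y z].
Proof.
move=> Od Oh Oy r00; have [_ Oo _] := Od.
have [rO rO0 rOO] := open_has_rball Oo Oy.
pose r := Num.min (rO / 2) r0.
have rp : 0 < r by rewrite lt_min r00 divr_gt0.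
have rrO : r <= rO / 2 by rewrite ge_min lexx.
pose S := [set x : V | rnorm (x - y) <= r] `&` ~` [set x | rnorm (x - y) < r].
have Sc : compact S.
  apply: (subclosed_compact _ (@compact_rball R n y r)); last by move=> x [].
  apply: closedI; first exact: closed_rball.
  by apply: open_closedC; exact: rball_open.
pose P (M : R) x := 0 < M /\ M^-1 <= pathdist Omega y x.
have Pmono M M' x : M <= M' -> P M x -> P M' x.
  move=> MM' [M0 H]; have M'0 := lt_le_trans M0 MM'; split=> //.
  by apply: le_trans H; rewrite lef_pV2 ?posrE.
have [|M MP] := compact_uniform Sc Pmono.
  move=> x [/= xr /negP]; rewrite -leNgt => rx.
  have Ox : Omega x by apply: rOO; lra.
  have yx := domain_component Od Oy Ox.
  have a0 : 0 < pathdist Omega y x.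
    rewrite lt0r pathdist_ge0 // andbT; apply/eqP => e0.
    have yxE : y = x by apply: Oh => //; rewrite kobayashiE // e0.
    by move: rx; rewrite yxE subrr rnorm0; lra.
  have a20 : 0 < pathdist Omega y x / 2 by rewrite divr_gt0.
  exists (pathdist Omega y x / 2)^-1.
  have := reach_short Oo Ox a20; apply: filterS => x' xx'.
  rewrite /P invr_gt0 invrK; split=> //.
  have [l xl ll] := xx'.
  have h1 := pathdist_le (reach_sym xl).
  have x'x := reach_component (reach_sym xl).
  have := pathdist_triangle Oo (connected_component_trans yx (reach_component xl)) x'x.
  lra.
exists r, (Num.max M 1)^-1; split=> //.
- by rewrite ge_min lexx orbT.
- by rewrite invr_gt0 lt_max ltr01 orbT.
move=> z Oz zr; apply: pathdist_ge => //; first exact: domain_component.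
move=> l [g gL [g0 gl]]; have l0 := chain_ge0 gL.
have [|gout|t1 [/andP[t10 t1l] rt1 t1in]] := @chain_first_exit _ _ _ y r gL.
- by rewrite g0 subrr rnorm0.
- by have := gout l; rewrite l0 lexx gl => /(_ isT); lra.
have [|M0 Mr] := MP (g t1).
  split; first by apply: t1in; rewrite t10 lexx.
  by apply/negP; rewrite -leNgt.
have := chain_reach gL (lexx 0) t10 t1l; rewrite g0 subr0 => /pathdist_le h.
have : (Num.max M 1)^-1 <= M^-1.
  by rewrite lef_pV2 ?posrE ?lt_max ?M0 // le_max lexx.
lra.
Qed.

(** Each point y of K is separated from p by a sphere around y, uniformly in K. *)
Lemma pathdist_far Omega K p : domain Omega -> hyperbolic Omega -> compact K -> K `<=` Omega ->
  ~ Omega p -> exists2 m : R, 0 < m & forall y z, K y -> Omega z -> rnorm (z - p) < m ->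
    m <= pathdist Omega z y.
Proof.
move=> Od Oh Kc KO Op; have [_ Oo _] := Od.
pose P (M : R) y := 0 < M /\ forall z, Omega z -> rnorm (z - p) < M^-1 ->
   M^-1 <= pathdist Omega z y.
have Pmono M M' y : M <= M' -> P M y -> P M' y.
  move=> MM' [M0 H]; have M'0 := lt_le_trans M0 MM'; split=> // z Oz zp.
  have i : M'^-1 <= M^-1 by rewrite lef_pV2 ?posrE.
  by apply: (le_trans i (H z Oz _)); exact: lt_le_trans zp i.
have [|M MP] := compact_uniform Kc Pmono.
  move=> y Ky; have Oy := KO _ Ky.
  have d0 : 0 < rnorm (y - p).
    by rewrite rnorm_gt0 subr_eq0; apply/eqP => yp; apply: Op; rewrite -yp.
  set d := rnorm (y - p) in d0.
  have d20 : 0 < d / 2 by rewrite divr_gt0.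
  have [r [m [r0 rd m0 mP]]] := pathdist_sphere_lower Od Oh Oy d20.
  have m20 : 0 < m / 2 by rewrite divr_gt0.
  pose e := Num.min (m / 2) (d / 2).
  have e0 : 0 < e by rewrite lt_min m20.
  have em : e <= m / 2 by rewrite ge_min lexx.
  have ed : e <= d / 2 by rewrite ge_min lexx orbT.
  exists e^-1; have := reach_short Oo Oy m20; apply: filterS => y' yy'.
  have [l yl lm] := yy'.
  rewrite /P invrK invr_gt0; split=> // z Oz ze.
  have yz : r <= rnorm (z - y).
    by have := ler_rdistD z y p; rewrite (rnormB y z) -/d; lra.
  have h := mP z Oz yz; have h2 := pathdist_le (reach_sym yl).
  have zy := domain_component Od Oz Oy.
  have := pathdist_triangle Oo (connected_component_trans zy (reach_component yl))
    (reach_component (reach_sym yl)).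
  rewrite (pathdist_sym Omega z y); lra.
have M0 : 0 < Num.max M 1 by rewrite lt_max ltr01 orbT.
exists (Num.max M 1)^-1; first by rewrite invr_gt0.
have MM : M <= Num.max M 1 by rewrite le_max lexx.
by move=> y z Ky; have [_] := Pmono _ _ _ MM (MP _ Ky); exact.
Qed.

(** A near-geodesic from z to x with defect e meets K, so the distance from z to K
    is at most the distance from z to x plus e; the same K serves all e <= 1. *)
Lemma visible_lower Omega U p (lambda : R) : domain Omega -> hyperbolic Omega ->
  ~ Omega p -> 1 <= lambda -> visible Omega p lambda -> open U -> U p -> bounded_set U ->
  exists r c : R, [/\ 0 < r, 0 < c & forall z x, Omega z -> rnorm (z - p) < r ->
    Omega x -> ~ U x -> c <= pathdist Omega z x].
Proof.
move=> Od Oh Op l1 vis Uo Up Ub; have [_ Oo _] := Od.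
have [W [K [Wo Wp _ [Kc KO] WK]]] := vis 1 ler01 _ Uo Up Ub.
have [m m0 mP] := pathdist_far Od Oh Kc KO Op.
have [rW rW0 rWW] := open_has_rball Wo Wp.
exists (Num.min rW m), m; split=> //; first by rewrite lt_min rW0.
move=> z x Oz; rewrite lt_min => /andP[zW zm] Ox Ux.
rewrite leNgt; apply/negP => rm.
pose e := Num.min 1 ((m - pathdist Omega z x) / 2).
have e0 : 0 < e by rewrite lt_min ltr01 divr_gt0 // subr_gt0.
have e1 : e <= 1 by rewrite ge_min lexx.
have e2 : e <= (m - pathdist Omega z x) / 2 by rewrite ge_min lexx orbT.
have [L [g [gL gg g0 gx Lr]]] := almost_geodesic Oo l1 e0 (domain_component Od Oz Ox).
have [||t /andP[t0 tL] Kt] := WK _ _ _ (geodesic_restrict (chain_ge0 gL) (lexx L) e1 gg).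
- by rewrite g0; exact: rWW.
- by rewrite gx.
have := chain_reach gL (lexx 0) t0 tL; rewrite g0 subr0 => /pathdist_le h.
have := mP _ _ Kt Oz zm; lra.
Qed.

(** Here the exit from the ball is already witnessed by a point of K on the chain
    itself, before the exit time and hence in the closed ball. *)
Theorem comparison_visible Omega U p (lambda : R) :
  domain Omega -> hyperbolic Omega -> ~ Omega p -> open U -> U p -> 1 <= lambda ->
  visible Omega p lambda -> bounded_set U ->
  exists r', 0 < r' /\ [set y | rnorm (y - p) <= r'] `<=` U /\
  exists2 C0 : R, 1 <= C0 & forall z w, Omega z -> rnorm (z - p) < r' ->
    Omega w -> rnorm (w - p) < r' -> connected_component (Omega `&` U) z w ->
    pathdist (Omega `&` U) z w <= C0 * pathdist Omega z w.
Proof.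
move=> Od Oh Op Uo Up l1 vis Ub; have [_ Oo _] := Od.
have [r1 [c1 [r10 c10 c1P]]] := visible_lower Od Oh Op l1 vis Uo Up Ub.
have [rU rU0 rUU] := open_has_rball Uo Up.
pose r := Num.min r1 rU / 2.
have m0 : 0 < Num.min r1 rU by rewrite lt_min r10.
have mr : Num.min r1 rU <= r1 by rewrite ge_min lexx.
have mU : Num.min r1 rU <= rU by rewrite ge_min lexx orbT.
have r0 : 0 < r by rewrite divr_gt0.
have rU' : [set y | rnorm (y - p) <= r] `<=` U.
  by move=> y /= yr; apply: rUU; rewrite /r in yr; lra.
have cloc : localized Omega [set y | rnorm (y - p) <= r] U (tanh c1).
  split; [by rewrite -(@tanh0 R) ltr_tanh|exact/ltW/tanh_lt1|].
  move=> phi phiD /= p0 z zc; apply: contrapT => nU.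
  have z1 : normc z < 1 by apply: lt_trans zc (tanh_lt1 _).
  have [l /pathdist_le h tl] := reach_disc_any phiD z1.
  have /holomorphic_discP phiD' := phiD.
  have Op0 : Omega (phi 0).
    by apply: (phiD' 0 _).1; rewrite ComplexField.Normc.normc0.
  have := c1P (phi 0) (phi z) Op0 ltac:(rewrite /r in p0; lra) (phiD' z z1).1 nU.
  have : l < c1 by rewrite -ltr_tanh tl.
  lra.
have Bp : [set y : V | rnorm (y - p) < r] p by rewrite /= subrr rnorm0.
have [r3 [c' [r30 c'0 c'P]]] :=
  visible_lower Od Oh Op l1 vis (@rball_open p r) Bp (@rball_bounded p r).
have [W [K [Wo Wp _ [Kc KO] WK]]] := vis 1 ler01 _ (@rball_open p r) Bp (@rball_bounded p r).
have [rW rW0 rWW] := open_has_rball Wo Wp.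
pose r' := Num.min rW (Num.min r3 r).
have r'0 : 0 < r' by rewrite !lt_min rW0 r30.
have r'W : r' <= rW by rewrite ge_min lexx.
have r'3 : r' <= r3 by rewrite !ge_min lexx orbT.
have r'r : r' <= r by rewrite !ge_min lexx !orbT.
exists r'; split=> //; split.
  by move=> y /= yr; apply: rU' => /=; exact: le_trans r'r.
apply: (@comparison_of_exits _ _ (K `&` [set y | rnorm (y - p) <= r]) p lambda r r' (tanh c1) c'
  (6 / tanh c1) 0) => //.
- move=> z x Oz zr Ox xr; apply: c'P => //=; first exact: lt_le_trans r'3.
  by apply/negP; rewrite -leNgt.
- by apply: compact_closedI => //; exact: closed_rball.
- by move=> y [Ky /rU' Uy]; split=> //; exact: KO.
- by rewrite divr_ge0 // tanh_ge0 ltW.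
move=> L g t1 gL /andP[t10 t1L] gg g0 gt1 t1in.
have [||t /andP[t0 tt1] Kt] := WK _ _ _ gg.
- by apply: rWW; lra.
- by apply/negP; rewrite -leNgt.
exists (g t), (6 / tanh c1 * t); split=> //.
- by split=> //; apply: t1in; rewrite t0.
- have := localized_reach cloc gL (lexx 0) t0 (le_trans tt1 t1L); rewrite subr0; apply.
  by move=> u /andP[u0 ut]; apply: t1in; rewrite u0 (le_trans ut).
rewrite addr0 ler_wpM2l // divr_ge0 // tanh_ge0 ltW //.
Qed.

End Localization.

Theorem theorem14 (R : realType) (n : nat) (Omega : set 'rV[R[i]]_n)
    (p : 'rV[R[i]]_n) (lambda : R) (U : set 'rV[R[i]]_n) :
  domain Omega -> hyperbolic Omega -> boundary Omega p -> 1 <= lambda ->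
  open U -> U p ->
  (visible Omega p lambda /\ bounded_set U) \/
  (visible (Omega `&` U) p lambda /\ hyperbolic_at Omega p) ->
  exists V : set 'rV[R[i]]_n, exists C : R,
    [/\ open V, V p, relatively_compact V U, 1 <= C &
        forall z w, Omega z -> V z -> Omega w -> V w ->
          connected_component (Omega `&` U) z w ->
          (kobayashi (Omega `&` U) z w <= C%:E * kobayashi Omega z w)%E].
Proof.
move=> Od Oh [_ Opi] l1 Uo Up H; have [_ Oo _] := Od.
have Op : ~ Omega p by move=> Op; apply: Opi; apply: open_nbhs_nbhs.
have [r [r0 [rU [C0 C01 CP]]]] : exists r', 0 < r' /\ [set y | rnorm (y - p) <= r'] `<=` U /\
  exists2 C0 : R, 1 <= C0 & forall z w, Omega z -> rnorm (z - p) < r' ->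
    Omega w -> rnorm (w - p) < r' -> connected_component (Omega `&` U) z w ->
    pathdist (Omega `&` U) z w <= C0 * pathdist Omega z w.
  case: H => [[vis Ub]|[vis hyp]]; first exact: comparison_visible vis Ub.
  exact: comparison_hyperbolic_at vis hyp.
exists [set y | rnorm (y - p) < r], C0; split=> //.
- exact: rball_open.
- by rewrite /= subrr rnorm0.
- exact: rball_relatively_compact.
move=> z w Oz zr Ow wr zw.
rewrite kobayashiE //; last exact: openI.
rewrite (kobayashiE Oo (domain_component Od Oz Ow)) -EFinM lee_fin.
exact: CP.
Qed.
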